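(* Let $1/2\le\underline{s}\le\overline{s}<1$, let $\Lambda_1,\Lambda_2\ge0$, and let $K:\mathbb{R}\setminus\{0\}\to\mathbb{R}$ be a measurable kernel such that $K(z)>0$, $K(-z)=K(z)$ and $K(z)\le\frac{\Lambda_1}{|z|^{1+2\underline{s}}}+\frac{\Lambda_2}{|z|^{1+2\overline{s}}}$ for all $z\neq0$. Let $L u(x)=\mathrm{P.V.}\int_{\mathbb{R}}(u(x)-u(y))K(x-y)\,dy$ and let $c:\mathbb{R}\to\mathbb{R}$ be a function. For some $\alpha>2\overline{s}-1$, let $w$ and $\widetilde w$ be $C^{1,\alpha}$ functions in $\mathbb{R}$. Assume that one of the following holds: (i) $w$ and $\widetilde w$ are both bounded, $[w']_{C^\alpha(\mathbb{R})}$ and $[\widetilde w']_{C^\alpha(\mathbb{R})}$ are finite, $w>0$ in $\mathbb{R}$, and there are positive constants $c_0,R_0$ such that $c(x)\le-c_0<0$ for $x\in\mathbb{R}\setminus[-R_0,R_0]$; or (ii) there is a constant $C>0$ such that $0<C^{-1}\le w(x)\le C$ for all $x\in\mathbb{R}$ and $\|\widetilde w\|_{L^\infty(-R,R)}\le C R^{\underline{s}-1/2}$ for every $R>1$. In addition, assume that $Lw-cw\ge0$ in $\mathbb{R}$ and $L\widetilde w-c\widetilde w=0$ in $\mathbb{R}$. Then $\widetilde w/w$ is constant in $\mathbb{R}$.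
   Context: All functions are real valued on $\mathbb{R}$. $\mathrm{P.V.}\int_{\mathbb{R}}(u(x)-u(y))K(x-y)\,dy=\lim_{\varepsilon\to0^+}\int_{|x-y|>\varepsilon}(u(x)-u(y))K(x-y)\,dy$; equations and inequalities are understood pointwise at every $x\in\mathbb{R}$. A function is $C^{1,\alpha}$ if it is $C^1$ with locally $\alpha$-Hölder continuous derivative, and $[g]_{C^\alpha(\mathbb{R})}=\sup_{x\ne y}|g(x)-g(y)|/|x-y|^\alpha$ is the global Hölder seminorm. *)

(* Defs.v *)
From mathcomp Require Import all_boot all_order all_algebra.
From mathcomp Require Import all_classical all_reals all_analysis.

Set Implicit Arguments.
Unset Strict Implicit.
Unset Printing Implicit Defensive.

Import Order.TTheory GRing.Theory Num.Theory.
Import numFieldNormedType.Exports.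

Local Open Scope classical_set_scope.
Local Open Scope ring_scope.

(* [measurable] on [R] itself means Borel.  This is R with the sigma-algebra of
   Lebesgue-measurable sets, the domain of [completed_lebesgue_measure]; see
   [completed_caratheodory_measurable]. *)
Definition lebesgueType (R : realType) :=
  caratheodory_type ((wlength (idfun : R -> R))^*)%mu.

(* [lim] and the real-valued integral are total.  For the functions of the
   theorem the truncated integrands are integrable, thanks to the growth of u
   and the bound on K at infinity, and the limit exists, thanks to the
   regularity of u and the evenness of K, so no default value is involved. *)
Definition nonlocal_op (R : realType) (K u : R -> R) (x : R) : R :=
  lim ((fun eps : R =>
     \int[completed_lebesgue_measure]_(y in [set y : R | eps < `|x - y|])
       ((u x - u y) * K (x - y))) @ 0^'+).

Definition holder_seminorm (R : realType) (alpha : R) (g : R -> R) : \bar R :=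
  ereal_sup [set q | exists x y : R,
    x != y /\ q = (`|g x - g y| / `|x - y| `^ alpha)%:E].

Definition holder_on (R : realType) (alpha : R) (A : set R) (g : R -> R) :=
  exists C : R, forall x y, A x -> A y ->
    `|g x - g y| <= C * `|x - y| `^ alpha.

Definition locally_holder (R : realType) (alpha : R) (g : R -> R) :=
  forall A : set R, compact A -> holder_on alpha A g.

Definition C1holder (R : realType) (alpha : R) (u : R -> R) :=
  [/\ forall x : R, derivable u x 1,
      continuous (derive1 u) &
      locally_holder alpha (derive1 u)].

(* The value K 0 is irrelevant: K is a function on R \ {0}. *)
Definition admissible_kernel (R : realType) (s_lo s_hi Lambda1 Lambda2 : R)
    (K : R -> R) :=
  [/\ measurable_fun ([set~ 0] : set (lebesgueType R)) (K : lebesgueType R -> R),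
      forall z, z != 0 -> 0 < K z,
      forall z, z != 0 -> K (- z) = K z &
      forall z, z != 0 ->
        K z <= Lambda1 / `|z| `^ (1 + 2 * s_lo)
               + Lambda2 / `|z| `^ (1 + 2 * s_hi)].

Definition Linfty_norm (R : realType) (A : set R) (f : R -> R) : \bar R :=
  'N[@completed_lebesgue_measure R]_(+oo%E)[EFin \o patch (fun=> 0) A f].

(* Main.v *)
Require Import Defs.
From mathcomp Require Import all_boot all_order all_algebra.
From mathcomp Require Import all_classical all_reals all_analysis.
From mathcomp Require Import measurable_realfun ess_sup_inf ring lra.
Import Order.TTheory GRing.Theory Num.Theory.
Import numFieldNormedType.Exports.
Local Open Scope classical_set_scope.
Local Open Scope ring_scope.

(** The ratio [wt / w] is constant for two different reasons.

    When [c <= - c0 < 0] outside a compact interval, the maximum principle is enough.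
    Let [q] be the maximum of [|wt / w|] on that interval, attained at [x0], and let
    [v = b * wt - q * w], where [b = 1] or [b = - 1] is the sign of [wt x0 / w x0].  Since
    [q >= 0], [v] is a subsolution; it is nonpositive on the interval and vanishes at [x0].
    At a point where [v] nearly reaches a positive supremum, [L v] is almost nonnegative, while
    [c v] is negative and bounded away from 0 ([weak_maximum_principle]): hence [v <= 0]
    on the line.  Then [v] has a maximum at [x0] with [L v x0 <= 0], and since [K > 0]
    everywhere [v] vanishes identically ([strong_maximum_principle]).

    In the other case, the ratio [s = wt / w] solves an equation in divergence form with
    the symmetric kernel [w x * w y * K (x - y)], up to a term with a good sign.  Testing it
    against [eta ^ 2 * s], for a cutoff [eta] at scale [r], bounds the energy of [s] on
    the region where [eta = 1] by the energy of [eta] weighted by [s ^ 2].  The latter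
    stays bounded as [r] tends to infinity: this is where [s_lo >= 1 / 2] and the growth
    [r ^ (s_lo - 1 / 2)] enter ([integral_near_far]).  So [s] has finite energy
    ([energy_coarse]); the part of it that lives where [eta] is not constant is then a
    tail of a convergent integral, and a second use of the same inequality, with a small
    parameter in front of the energy of [eta], shows that the energy of [s] is zero
    ([energy_fine], [ratio_constant_energy]).

    In both cases the principal value is first replaced by an absolutely convergent integral
    of second differences ([nonlocal_opE]).  Besides making linearity available, this lets
    the test function be integrated without truncating the kernel: by Fubini and a
    translation of the variable, the integral of the second differences turns into the
    symmetric bilinear form ([tested_form_le0]). *)

(** * Lebesgue measure under translations and reflections *)

(** A map that preserves the measure preserves integrals of nonnegative functions, hence
    those of signed functions, through their positive and negative parts. *)
Lemma integral_invariant d (T : measurableType d) {R : realType}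
    (m : {measure set T -> \bar R}) (phi : T -> T) (D : set T) (f : T -> \bar R) :
  measurable_fun setT phi -> (forall A, measurable A -> m (phi @^-1` A) = m A) ->
  measurable D -> measurable_fun D f ->
  (\int[m]_(y in D) f y = \int[m]_(y in phi @^-1` D) f (phi y))%E.
Proof.
move=> mphi m_phi mD mf.
have ge0 g : measurable_fun D g -> (forall y, 0 <= g y)%E ->
    (\int[m]_(y in D) g y = \int[m]_(y in phi @^-1` D) g (phi y))%E.
  move=> mg g0; rewrite -[RHS](ge0_integral_pushforward mphi m mD mg)//.
  by apply: eq_measure_integral => A mA _; exact/esym/m_phi.
rewrite integralE [RHS]integralE; congr (_ - _)%E.
  rewrite (ge0 _ (measurable_funepos mf))//.
  by apply: eq_integral => y _; rewrite !funeposE.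
rewrite (ge0 _ (measurable_funeneg mf))//.
by apply: eq_integral => y _; rewrite !funenegE.
Qed.

Section lebesgue_invariance.
Context {R : realType}.
Notation mu := (@lebesgue_measure R).
Notation cmu := (@completed_lebesgue_measure R).
Implicit Types (f : R -> \bar R) (a x : R).

Lemma measurable_shift a : measurable_fun setT (fun y : R => y + a : R).
Proof. by apply: continuous_measurable_fun => y; apply: cvgD => //; exact: cvg_cst. Qed.

Lemma lebesgue_measure_shift a (A : set R) : measurable A ->
  mu ((fun y => y + a) @^-1` A) = mu A.
Proof.
move=> mA; have mf := measurable_shift a.
suff : mu A = pushforward mu ((fun y => y + a) : measurableTypeR R -> measurableTypeR R) A.
  by [].
apply: lebesgue_measure_unique => //= _ [[b c]] _ <-.
rewrite /pushforward.
have -> : (fun y => y + a) @^-1` `]b, c]%classic = `]b - a, c - a]%classic.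
  by apply/seteqP; split=> y /=; rewrite !in_itv/= ltrBlDr lerBrDr.
by rewrite !lebesgue_measure_itv/= !lte_fin ltrD2r -!EFinB; case: ifPn => // _;
  congr EFin; ring.
Qed.

Lemma lebesgue_measure_reflect x (A : set R) : measurable A ->
  mu ((fun y : R => (x - y)%R) @^-1` A) = mu A.
Proof.
move=> mA.
have -> : (fun y : R => (x - y)%R) @^-1` A = (fun y => y - x) @^-1` (-%R @^-1` A).
  by apply/seteqP; split=> y /=; rewrite opprB.
rewrite lebesgue_measure_shift; first exact: lebesgue_measureN.
have mN : measurable_fun setT (-%R : R -> R) by exact: continuous_measurable_fun oppr_continuous.
by rewrite -(setTI (_ @^-1` _)); exact: mN.
Qed.

(** Reflections preserve open sets, whose measures determine the outer measure.  This is
    what makes reflections available for Lebesgue measurable sets, and not only for Borel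
    sets. *)
Lemma outer_reflect x (A : set R) :
  ((wlength (idfun : R -> R))^* ((fun y : R => (x - y)%R) @^-1` A))%mu =
  ((wlength (idfun : R -> R))^* A)%mu.
Proof.
have le (B : set R) : (((wlength (idfun : R -> R))^* ((fun y : R => (x - y)%R) @^-1` B))%mu <=
  ((wlength (idfun : R -> R))^* B)%mu)%E.
  rewrite [leRHS]outer_measure_open; apply: le_ereal_inf_tmp => /= _ [U [oU BU] <-].
  rewrite -[leRHS]/(mu U) -(@lebesgue_measure_reflect x U); last exact: open_measurable.
  by apply: le_outer_measure => y; exact: BU.
apply/eqP; rewrite eq_le le/=.
have {1}-> : A = (fun y : R => (x - y)%R) @^-1` ((fun y : R => (x - y)%R) @^-1` A).
  by apply/seteqP; split=> y /=; rewrite opprB addrC subrK.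
exact: le.
Qed.

Lemma measurable_lebesgue_reflect x :
  measurable_fun setT ((fun y : R => (x - y)%R) : lebesgueType R -> lebesgueType R).
Proof.
move=> _ A mA; rewrite setTI.
have {}mA : caratheodory_measurable ((wlength (idfun : R -> R))^*)%mu A by exact: mA.
suff : caratheodory_measurable ((wlength (idfun : R -> R))^*)%mu
  ((fun y : R => (x - y)%R) @^-1` A) by [].
move=> B.
have H (C : set R) : C = (fun y : R => (x - y)%R) @^-1` ((fun y : R => (x - y)%R) @^-1` C).
  by apply/seteqP; split=> y /=; rewrite opprB addrC subrK.
rewrite -(outer_reflect x B) (mA ((fun y : R => (x - y)%R) @^-1` B)).
rewrite -(outer_reflect x (B `&` ((fun y : R => (x - y)%R) @^-1` A))).
rewrite -(outer_reflect x (B `&` ~` ((fun y : R => (x - y)%R) @^-1` A))).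
by rewrite !preimage_setI preimage_setC -(H A) -(H (~` A)).
Qed.

Lemma measurable_borel_lebesgue d (T : measurableType d) (f : R -> T) :
  measurable_fun setT f -> measurable_fun setT (f : lebesgueType R -> T).
Proof.
move=> mf _ A mA; apply: sub_caratheodory; exact: mf.
Qed.

Lemma integral_reflect x (D : set R) (f : lebesgueType R -> \bar R) :
  measurable (D : set (lebesgueType R)) ->
  measurable_fun (D : set (lebesgueType R)) f ->
  (\int[cmu]_(y in D) f y = \int[cmu]_(y in (fun y : R => (x - y)%R) @^-1` D) f (x - y)%R)%E.
Proof.
move=> mD mf.
apply: (integral_invariant _ _ cmu _ _ _ (measurable_lebesgue_reflect x)) => // A _.
exact: outer_reflect.
Qed.

Lemma integral_shift a f : measurable_fun setT f ->
  (\int[mu]_y f (y + a)%R = \int[mu]_y f y)%E.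
Proof.
move=> mf; symmetry.
apply: (integral_invariant _ (measurableTypeR R) mu (fun y : R => y + a) setT f) => //.
  exact: measurable_shift.
by move=> A mA; exact: lebesgue_measure_shift.
Qed.

Lemma ge0_integral_completed (D : set R) f : measurable D -> measurable_fun D f ->
  (forall y, D y -> 0 <= f y)%E -> (\int[cmu]_(y in D) f y = \int[mu]_(y in D) f y)%E.
Proof.
move=> mD mf f0.
have mid : measurable_fun setT (idfun : lebesgueType R -> measurableTypeR R).
  by apply: measurable_borel_lebesgue; exact: measurable_id.
have f0' : {in D, forall y, (0 <= f y)%E} by move=> y /[!inE]; exact: f0.
have := @ge0_integral_pushforward _ _ _ _ _ _ mid cmu D f mD mf f0'.
by move=> <-; apply: eq_measure_integral => A mA _.
Qed.

(** A neighbourhood is not negligible, even without the origin; this turns statements that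
    hold almost everywhere into statements about continuous functions. *)
Lemma near_not_null (y : R) (P : R -> Prop) (N : set R) :
  measurable (N : set (lebesgueType R)) -> cmu N = 0%E -> (\forall z \near y, P z) ->
  exists z, [/\ P z, z != 0 & ~ N z].
Proof.
move=> mN N0 /nbhs_ballP[r /= r0 hr]; apply: contrapT => /forallNP h.
(* an interval with endpoint y inside the neighbourhood that avoids the origin *)
pose b := if 0 <= y then y + r else Num.min (y + r) 0.
have yb : y < b.
  rewrite /b; case: ifPn => [_|]; first by rewrite ltrDl.
  by rewrite -ltNge => y0; rewrite lt_min ltrDl r0.
have bN : `]y, b[%classic `<=` N.
  move=> z; rewrite /= in_itv/= => /andP[yz zb]; apply: contrapT => Nz.
  apply: (h z); split => //.
    apply: hr; rewrite /ball/= distrC gtr0_norm ?subr_gt0// ltrBlDl (lt_le_trans zb)// /b.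
    by case: ifP => // _; rewrite ge_min lexx.
  move: zb; rewrite /b; case: ifPn => [y0 _|_]; first by rewrite gt_eqF// (le_lt_trans y0).
  by rewrite lt_min => /andP[_ /lt_eqF ->].
have mI : measurable (`]y, b[%classic : set (lebesgueType R)).
  by apply: sub_caratheodory; exact: measurable_itv.
have : (cmu `]y, b[%classic <= cmu N)%E by apply: le_measure => //; rewrite inE.
rewrite N0 -[cmu _]/(mu `]y, b[%classic) lebesgue_measure_itv/= lte_fin yb.
by rewrite -EFinB lee_fin leNgt subr_gt0 yb.
Qed.

End lebesgue_invariance.

(** * Integrals of powers *)

Section power_integrals.
Context {R : realType}.
Notation mu := (@lebesgue_measure R).
Notation cmu := (@completed_lebesgue_measure R).

Lemma continuous_powR_pos (c x : R) : 0 < x -> {for x, continuous (fun t : R => t `^ c)}.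
Proof.
move=> x0; apply: differentiable_continuous; apply/derivable1_diffP.
by apply: derivable_powR; rewrite in_itv/= x0.
Qed.

Lemma integral_powR_segment (c x y : R) : c != 0 -> 0 < x -> x < y ->
  (\int[mu]_(t in `[x, y]) (t `^ (c - 1))%:E = (c^-1 * (y `^ c - x `^ c))%:E)%E.
Proof.
move=> c0 x0 xy.
have y0 : 0 < y by exact: lt_trans xy.
pose F := fun t : R => c^-1 * t `^ c.
have dF (t : R) : 0 < t -> is_derive t 1 F (t `^ (c - 1)).
  move=> t0; have h := is_derive1_powR c t0.
  have -> : t `^ (c - 1) = c^-1 *: (c * t `^ (c - 1)) by rewrite /GRing.scale/= mulKf.
  exact: is_deriveZ.
have cF (t : R) : 0 < t -> {for t, continuous F}.
  move=> t0; apply: differentiable_continuous; apply/derivable1_diffP.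
  by have [] := dF t t0.
rewrite (@continuous_FTC2 _ (fun t => t `^ (c - 1)) F)//.
- by rewrite -EFinB mulrBr.
- apply: continuous_in_subspaceT => t; rewrite inE/= in_itv/= => /andP[xt _].
  by apply: continuous_powR_pos; exact: lt_le_trans xt.
- split.
  + by move=> t; rewrite in_itv/= => /andP[xt _]; have [] := dF t (lt_trans x0 xt).
  + by apply: cvg_at_right_filter; exact: cF.
  + by apply: cvg_at_left_filter; exact: cF.
- move=> t; rewrite in_itv/= => /andP[xt _].
  by rewrite derive1E; have [_ ->] := dF t (lt_trans x0 xt).
Qed.

Lemma measurable_powRc (c : R) (D : set R) : measurable_fun D (EFin \o (fun t : R => t `^ c)).
Proof.
by apply/measurable_EFinP; apply: measurable_funTS; exact: measurable_powR.
Qed.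

(** Only upper bounds for the integrals of powers matter, so that a uniform bound on
    compact intervals, where the fundamental theorem of calculus applies, is enough for
    both kinds of improper integrals. *)
Lemma integral_powR_exhaustion (c M : R) (F : (set R)^nat) :
  nondecreasing_seq F -> (forall i, measurable (F i)) ->
  (forall i, (\int[mu]_(t in F i) (t `^ c)%:E <= M%:E)%E) ->
  (\int[mu]_(t in \bigcup_i F i) (t `^ c)%:E <= M%:E)%E.
Proof.
move=> nF mF FM.
have mf i : measurable_fun (F i) (EFin \o (fun t : R => t `^ c)) by exact: measurable_powRc.
have f0 i t : F i t -> (0 <= (t `^ c)%:E)%E by rewrite lee_fin powR_ge0.
have h := @ge0_nondecreasing_set_cvg_integral _ (measurableTypeR R) R F _ mu nF mF mf f0.
rewrite -(cvg_lim _ h)//; apply: lime_le; last by apply: nearW.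
by apply/cvg_ex; eexists; exact: h.
Qed.

Lemma integral_powR_near0 (a r : R) : 0 < a -> 0 < r ->
  (\int[mu]_(t in `]0%R, r]) (t `^ (a - 1))%:E <= (r `^ a / a)%:E)%E.
Proof.
move=> a0 r0.
pose F n := `[r / n.+2%:R, r]%classic : set R.
have rn n : 0 < r / n.+2%:R by rewrite divr_gt0.
have -> : `]0, r]%classic = \bigcup_n F n.
  apply/seteqP; split => t /=.
    rewrite in_itv/= => /andP[t0 tr].
    have [n nt] : exists n : nat, r / t < n%:R.
      by have := archi_boundP (ltW (divr_gt0 r0 t0)) => h; exists (Num.bound (r / t)).
    exists n => //; rewrite /F/= in_itv/= tr andbT ler_pdivrMr// mulrC -ler_pdivrMr//.
    by apply: (le_trans (ltW nt)); rewrite ler_nat; exact: leq_trans (leqnSn _) (leqnSn _).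
  move=> [n _]; rewrite /F/= !in_itv/= => /andP[+ ->]; rewrite andbT.
  exact: lt_le_trans.
apply: integral_powR_exhaustion.
- apply/nondecreasing_seqP => n; apply/subsetPset => t; rewrite /F/= !in_itv/= => /andP[+ ->].
  rewrite andbT; apply: le_trans; rewrite ler_pM2l// lef_pV2 ?posrE//.
  by rewrite ler_nat.
- by move=> i; exact: measurable_itv.
- move=> n; rewrite integral_powR_segment ?gt_eqF//; last first.
    by rewrite ltr_pdivrMr// ltr_pMr// ltr1n.
  rewrite lee_fin mulrC ler_pM2r ?invr_gt0// gerBl; exact: powR_ge0.
Qed.

Lemma integral_powR_nearoo (b r : R) : 0 < b -> 0 < r ->
  (\int[mu]_(t in `]r, +oo[) (t `^ (- b - 1))%:E <= (r `^ (- b) / b)%:E)%E.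
Proof.
move=> b0 r0.
pose F n := `[r, r + n.+1%:R]%classic : set R.
have -> : (\int[mu]_(t in `]r, +oo[) (t `^ (- b - 1))%:E =
   \int[mu]_(t in `[r, +oo[) (t `^ (- b - 1))%:E)%E.
  rewrite integral_itv_obnd_cbnd//; apply/measurable_EFinP/measurable_funTS.
  exact: measurable_powR.
have -> : `[r, +oo[%classic = \bigcup_n F n.
  apply/seteqP; split => t /=.
    rewrite in_itv/= andbT => rt.
    have [n nt] : exists n : nat, t - r < n%:R.
      by exists (Num.bound (t - r)); apply: archi_boundP; rewrite subr_ge0.
    exists n => //; rewrite /F/= in_itv/= rt/= -lerBlDl (le_trans (ltW nt))// ler_nat.
    exact: leqnSn.
  by move=> [n _]; rewrite /F/= !in_itv/= andbT => /andP[].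
apply: integral_powR_exhaustion.
- apply/nondecreasing_seqP => n; apply/subsetPset => t; rewrite /F/= !in_itv/= => /andP[->/=].
  by move/le_trans; apply; rewrite lerD2l ler_nat.
- by move=> i; exact: measurable_itv.
- move=> n; rewrite integral_powR_segment// ?oppr_eq0 ?gt_eqF//; last by rewrite ltrDl.
  rewrite lee_fin invrN mulNr -mulrN opprB mulrC ler_pM2r ?invr_gt0// gerBl.
  exact: powR_ge0.
Qed.

Lemma ge0_integral_even (E : set R) (g : R -> \bar R) : measurable E ->
  E `<=` `]0, +oo[ -> measurable_fun setT g -> (forall t, 0 <= g t)%E ->
  (\int[mu]_(z in [set z : R | E `|z|%R]) g `|z|%R =
   \int[mu]_(z in E) g z + \int[mu]_(z in E) g z)%E.
Proof.
move=> mE E0 mg g0.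
have mN : measurable_fun setT (-%R : R -> R) by exact: continuous_measurable_fun oppr_continuous.
have mNE : measurable (-%R @^-1` E) by rewrite -(setTI (_ @^-1` _)); exact: mN.
have mabs : measurable_fun setT (fun z : R => g `|z|%R).
  by apply: measurableT_comp => //; exact: normr_measurable.
have pos z : E z -> 0 < z by move=> /E0; rewrite /= in_itv/= andbT.
have -> : [set z | E `|z|] = E `|` (-%R @^-1` E).
  apply/seteqP; split => z /=.
    by have [z0 Ez|z0 Ez] := ger0P z; [left|right].
  case=> [Ez|Ez]; first by rewrite gtr0_norm//; exact: pos.
  by rewrite ltr0_norm// -oppr_gt0; exact: pos.
rewrite ge0_integral_setU//; last 2 first.
- exact: measurable_funTS.
- apply/disj_setPS => z [/= /pos z0 /pos]; rewrite oppr_gt0 => z1.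
  by have := lt_trans z0 z1; rewrite ltxx.
congr (_ + _)%E.
  by apply: eq_integral => z; rewrite inE => /pos z0; rewrite gtr0_norm.
rewrite -[LHS]ge0_integral_completed//; last exact: measurable_funTS.
rewrite -[RHS]ge0_integral_completed//; last exact: measurable_funTS.
have -> : -%R @^-1` E = (fun y : R => (0 - y)%R) @^-1` E.
  by apply/seteqP; split=> z /=; rewrite sub0r.
rewrite (integral_reflect 0 E)//.
- apply: eq_integral => z; rewrite inE/= => /pos; rewrite sub0r => z0.
  by rewrite ltr0_norm// -oppr_gt0.
- exact: sub_caratheodory.
- by apply: measurable_funTS; exact: measurable_borel_lebesgue.
Qed.

End power_integrals.

(** * Second differences *)

Definition sdiff {R : realType} (u : R -> R) (x z : R) : R :=
  2 * u x - u (x + z) - u (x - z).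

Section second_difference.
Context {R : realType}.
Implicit Types f u v : R -> R.

Lemma continuous_translate f a : continuous f -> continuous (fun x => f (x + a)).
Proof.
move=> cf x; apply: (@continuous_comp _ _ _ (fun x => x + a) f); last exact: cf.
by apply: cvgD; [exact: cvg_id|exact: cvg_cst].
Qed.

Lemma continuous_increment f x : continuous f -> continuous (fun z => f (x + z)).
Proof.
by move=> cf; under eq_fun do rewrite addrC; exact: continuous_translate.
Qed.

Lemma continuous_decrement f x : continuous f -> continuous (fun z => f (x - z)).
Proof.
move=> cf z; apply: (@continuous_comp _ _ _ (fun z => x - z) f); last exact: cf.
by apply: cvgB; [exact: cvg_cst|exact: cvg_id].
Qed.

Lemma continuous_normr f : continuous f -> continuous (fun x => `|f x|).
Proof.
move=> cf x; apply: (@continuous_comp _ _ _ f (fun y => `|y|)); first exact: cf.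
exact: norm_continuous.
Qed.

(** Twice the mean value theorem: a second difference is a first difference of derivatives
    at two points of [[x - |z|, x + |z|]]. *)
Lemma sdiff_holder u (alpha C x z : R) : 0 <= alpha -> 0 <= C ->
  (forall y, derivable u y 1) ->
  (forall y y', `|y - x| <= `|z| -> `|y' - x| <= `|z| ->
     `|derive1 u y - derive1 u y'| <= C * `|y - y'| `^ alpha) ->
  `|sdiff u x z| <= C * 2 `^ alpha * `|z| `^ (1 + alpha).
Proof.
move=> a0 C0 du hu.
wlog z0 : z hu / 0 < z.
  move=> h; have [z0|z0|z0e] := ltgtP z 0; last 2 first.
  - exact: (h z hu z0).
  - rewrite z0e /sdiff addr0 subr0 (_ : _ - _ - _ = 0); last by ring.
    by rewrite normr0 mulr_ge0 ?mulr_ge0 ?powR_ge0.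
  have -> : sdiff u x z = sdiff u x (- z) by rewrite /sdiff opprK; ring.
  rewrite -(normrN z); apply: h; rewrite ?normrN ?oppr_gt0//.
have dF (y : R) : is_derive y 1 u (derive1 u y) by rewrite derive1E; exact/derivableP.
have cu : continuous u.
  by move=> y; apply: differentiable_continuous; apply/derivable1_diffP.
have mvt (a b : R) : a < b ->
    exists2 c, c \in `]a, b[ & u b - u a = derive1 u c * (b - a).
  move=> ab; by apply: MVT => //; exact: continuous_subspaceT.
have [c1 + e1] := mvt x (x + z) (ltac:(by rewrite ltrDl)).
rewrite in_itv/= => /andP[xc1 c1z].
have [c2 + e2] := mvt (x - z) x (ltac:(by rewrite gtrBl)).
rewrite in_itv/= => /andP[zc2 c2x].
have -> : sdiff u x z = (derive1 u c2 - derive1 u c1) * z.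
  have e3 : u (x + z) - u x = derive1 u c1 * z by rewrite e1; ring.
  have e4 : u x - u (x - z) = derive1 u c2 * z by rewrite e2; ring.
  by rewrite mulrBl -e3 -e4 /sdiff; ring.
rewrite normrM (gtr0_norm z0).
have -> : z `^ (1 + alpha) = z `^ alpha * z.
  rewrite addrC powRD ?powRr1 ?ltW//; apply/implyP => _; exact: lt0r_neq0.
rewrite mulrA ler_pM2r// -mulrA -powRM ?(ltW z0)//.
apply: (le_trans (hu _ _ _ _)).
- by rewrite (gtr0_norm z0) ler_norml; apply/andP; split; lra.
- by rewrite (gtr0_norm z0) ler_norml; apply/andP; split; lra.
rewrite ler_wpM2l// ge0_ler_powR ?nnegrE ?mulr_ge0 ?(ltW z0)//.
by rewrite ler_norml; apply/andP; split; lra.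
Qed.

Lemma sdiff_comb (a b x z : R) u v :
  sdiff (fun y => a * u y - b * v y) x z = a * sdiff u x z - b * sdiff v x z.
Proof. by rewrite /sdiff; ring. Qed.

Lemma continuous_sdiff u x : continuous u -> continuous (sdiff u x).
Proof.
move=> cu z; rewrite /sdiff.
apply: cvgB; last exact: continuous_decrement.
by apply: cvgB; [exact: cvg_cst|exact: continuous_increment].
Qed.

End second_difference.

(** * Cutoffs and the pointwise energy inequalities *)

Definition cutoff {R : realType} (r x : R) : R := Num.max 0 (Num.min 1 (2 - `|x| / r)).

Section cutoff.
Context {R : realType}.
Implicit Types r x y : R.

Lemma cutoff_ge0 r x : 0 <= cutoff r x.
Proof. by rewrite /cutoff le_max lexx. Qed.

Lemma cutoff_le1 r x : cutoff r x <= 1.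
Proof. by rewrite /cutoff ge_max ler01 ge_min lexx. Qed.

Lemma cutoff_in r x : 0 < r -> `|x| <= r -> cutoff r x = 1.
Proof.
move=> r0 xr; have h : `|x| / r <= 1 by rewrite ler_pdivrMr// mul1r.
by rewrite /cutoff min_l; [rewrite max_r|lra].
Qed.

Lemma cutoff_out r x : 0 < r -> 2 * r < `|x| -> cutoff r x = 0.
Proof.
move=> r0 xr; have h : 2 < `|x| / r by rewrite ltr_pdivlMr.
by rewrite /cutoff min_r; [rewrite max_l//; lra|lra].
Qed.

Lemma cutoff_lip r x y : 0 < r -> `|cutoff r x - cutoff r y| <= `|x - y| / r.
Proof.
move=> r0; have h : `| `|x| / r - `|y| / r| <= `|x - y| / r.
  rewrite -mulrBl normrM (gtr0_norm (_ : 0 < r^-1)) ?invr_gt0// ler_pM2r ?invr_gt0//.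
  exact: ler_dist_dist.
move: h; rewrite /cutoff; set a := _ / r; set b := _ / r; set d := _ / r.
rewrite !ler_norml => /andP[h1 h2].
case: (leP 1 (2 - a)) => ha; case: (leP 1 (2 - b)) => hb.
- by rewrite max_r// subrr; apply/andP; split; lra.
- by rewrite (max_r ler01); case: (leP 0 (2 - b)) => ?; apply/andP; split; lra.
- by rewrite (max_r ler01); case: (leP 0 (2 - a)) => ?; apply/andP; split; lra.
- by case: (leP 0 (2 - b)) => ?; case: (leP 0 (2 - a)) => ?; apply/andP; split; lra.
Qed.

Lemma cutoff_mono r r' x : 0 < r -> r <= r' -> cutoff r x <= cutoff r' x.
Proof.
move=> r0 rr'; rewrite /cutoff.
have h : `|x| / r' <= `|x| / r.
  by rewrite ler_wpM2l// lef_pV2// posrE (lt_le_trans r0).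
rewrite ge_max le_max lexx/= le_max; apply/orP; right.
by rewrite le_min !ge_min lexx/= lerB// orbT.
Qed.

Lemma continuous_cutoff r : continuous (cutoff r).
Proof.
move=> x.
apply: (@continuous_max R R (cst 0) (fun x => Num.min 1 (2 - `|x| / r)) x); first exact: cvg_cst.
apply: (@continuous_min R R (cst 1) (fun x => 2 - `|x| / r) x); first exact: cvg_cst.
apply: cvgB; first exact: cvg_cst.
by apply: cvgM; [exact: norm_continuous|exact: cvg_cst].
Qed.

End cutoff.

Section algebra.
Context {R : realType}.

(** The discrete product rule: [A], [B] are the values of a cutoff at two points, and [a],
    [b] those of the function to be localised. *)
Lemma product_rule (A B a b : R) :
  (A ^+ 2 * a - B ^+ 2 * b) * (a - b) =
  2^-1 * (A ^+ 2 + B ^+ 2) * (a - b) ^+ 2 + 2^-1 * (A ^+ 2 - B ^+ 2) * (a - b) * (a + b).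
Proof. by field. Qed.

(** The cross term is absorbed by half of the main term, because
    [(A + B) ^ 2 <= 2 * (A ^ 2 + B ^ 2)]. *)
Lemma energy_coarse (A B a b : R) :
  4^-1 * ((A ^+ 2 + B ^+ 2) * (a - b) ^+ 2) <=
  (A ^+ 2 * a - B ^+ 2 * b) * (a - b) + 2^-1 * ((A - B) ^+ 2 * (a + b) ^+ 2).
Proof.
rewrite product_rule.
have h1 : 0 <= ((A + B) * (a - b) + 2 * ((A - B) * (a + b))) ^+ 2 by exact: sqr_ge0.
have h2 : 0 <= (A - B) ^+ 2 * (a - b) ^+ 2 by rewrite mulr_ge0 ?sqr_ge0.
lra.
Qed.

(** The cross term vanishes unless [A != B]: this puts a small weight on the energy of the
    cutoff, at the price of a large weight on a part of the energy of the function
    which is far away. *)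
Lemma energy_fine (A B a b t : R) : 0 < t -> 0 <= A <= 1 -> 0 <= B <= 1 ->
  2^-1 * ((A ^+ 2 + B ^+ 2) * (a - b) ^+ 2) <=
  (A ^+ 2 * a - B ^+ 2 * b) * (a - b) +
  (t / 4 * ((A - B) ^+ 2 * (a + b) ^+ 2) + t^-1 * ((A != B)%:R * (a - b) ^+ 2)).
Proof.
move=> t0 /andP[A0 A1] /andP[B0 B1]; rewrite product_rule.
(* when A != B, the difference of the two sides is a square plus a nonnegative term *)
have [->|AB] := eqVneq A B.
  by rewrite (subrr B) (subrr (B ^+ 2)) expr0n/= !(mul0r, mulr0, addr0) mulrA.
rewrite mul1r -subr_ge0.
have -> : forall X Y, 2^-1 * (A ^+ 2 + B ^+ 2) * (a - b) ^+ 2 + X + Y -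
   2^-1 * ((A ^+ 2 + B ^+ 2) * (a - b) ^+ 2) = X + Y by move=> X Y; ring.
have hS : (A + B) ^+ 2 <= 4 by nra.
have h1 : 0 <= t * ((A - B) * (a + b) + t^-1 * ((A + B) * (a - b))) ^+ 2.
  by rewrite mulr_ge0 ?sqr_ge0// ltW.
have h2 : 0 <= t^-1 * ((4 - (A + B) ^+ 2) * (a - b) ^+ 2).
  by rewrite mulr_ge0 ?invr_ge0 ?(ltW t0)// mulr_ge0 ?sqr_ge0// subr_ge0.
have -> : 2^-1 * (A ^+ 2 - B ^+ 2) * (a - b) * (a + b) +
  (t / 4 * ((A - B) ^+ 2 * (a + b) ^+ 2) + t^-1 * (a - b) ^+ 2) =
  4^-1 * (t * ((A - B) * (a + b) + t^-1 * ((A + B) * (a - b))) ^+ 2) +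
  4^-1 * (t^-1 * ((4 - (A + B) ^+ 2) * (a - b) ^+ 2)).
  by field; rewrite gt_eqF.
by rewrite addr_ge0// mulr_ge0// invr_ge0.
Qed.

End algebra.

(** * The kernel and the operator *)

(** The kernel extended by 0 at the origin, so that it is defined, measurable
    and nonnegative on the whole line. *)
Definition ker0 {R : realType} (K : R -> R) (z : R) : R := if z == 0 then 0 else K z.

(** The weight [2 + |y|] is larger than 1 and than [|y|]: it is the radius of an interval that
    contains [y] and to which a growth condition at radii larger than 1 applies. *)
Definition growth {R : realType} (beta : R) (u : R -> R) :=
  exists G : R, forall y, `|u y| <= G * (2 + `|y|) `^ beta.

(** Up to constants, this dominates the second differences of the functions under
    consideration: regularity near the origin, growth far away. *)
Definition majorant {R : realType} (alpha beta z : R) : R :=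
  if `|z| <= 1 then `|z| `^ (1 + alpha) else `|z| `^ beta.

Lemma growth_coef_ge0 (R : realType) (b G : R) (u : R -> R) :
  (forall y, `|u y| <= G * (2 + `|y|) `^ b) -> 0 <= G.
Proof.
have p0 : 0 < (2 + `|0 : R|) `^ b by apply: powR_gt0; rewrite normr0 addr0.
by move=> hG; have := le_trans (normr_ge0 _) (hG 0); rewrite pmulr_lge0.
Qed.

Section nonlocal_operator.
Context {R : realType} (s_lo s_hi L1 L2 alpha : R) (K : R -> R).
Hypotheses (hs_lo : 1 / 2 <= s_lo) (hs : s_lo <= s_hi) (hs_hi : s_hi < 1).
Hypotheses (hL1 : 0 <= L1) (hL2 : 0 <= L2).
Hypothesis hK : admissible_kernel s_lo s_hi L1 L2 K.
Hypothesis halpha : 2 * s_hi - 1 < alpha.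
Notation mu := (@lebesgue_measure R).
Notation cmu := (@completed_lebesgue_measure R).
Notation k := (ker0 K).
Notation beta := (s_lo - 1 / 2).
Notation X := (measurableTypeR R).
Notation T := (lebesgueType R).
Implicit Types u v f g : R -> R.

Lemma ker0_gt0 z : z != 0 -> 0 < k z.
Proof. by move=> z0; rewrite /ker0 (negbTE z0); case: hK => _ + _ _; apply. Qed.

Lemma ker0_ge0 z : 0 <= k z.
Proof.
have [->|z0] := eqVneq z 0; first by rewrite /ker0 eqxx.
exact/ltW/ker0_gt0.
Qed.

Lemma ker0N z : k (- z) = k z.
Proof.
rewrite /ker0 oppr_eq0; have [//|z0] := eqVneq z 0.
by case: hK => _ _ + _; apply.
Qed.

Lemma ker00 : k 0 = 0. Proof. by rewrite /ker0 eqxx. Qed.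

Lemma ker0_le z : z != 0 ->
  k z <= L1 / `|z| `^ (1 + 2 * s_lo) + L2 / `|z| `^ (1 + 2 * s_hi).
Proof. by move=> z0; rewrite /ker0 (negbTE z0); case: hK => _ _ _; apply. Qed.

Lemma measurable_ker0 : measurable_fun (setT : set (lebesgueType R)) (k : lebesgueType R -> R).
Proof.
have m0 : measurable ([set~ 0] : set (lebesgueType R)).
  by apply: sub_caratheodory; apply: measurableC; exact: measurable_set1.
have -> : (k : lebesgueType R -> R) = patch (fun=> 0) [set~ 0] K.
  apply/funext => z; rewrite /ker0 patchE; case: ifPn => [/eqP ->|z0].
    by rewrite memNset//= => /(_ erefl).
  by rewrite mem_set//=; exact/eqP.
by case: hK => mK _ _ _; exact: (measurable_restrictT _ m0).1.
Qed.

(** The two powers in the bound on the kernel are integrated separately; the region is given by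
    the set [E] of the values of [|z|], which covers both neighbourhoods of the
    origin and of infinity. *)
Lemma ge0_integral_ker0_le (E : set R) (p M1 M2 : R) : measurable E -> E `<=` `]0, +oo[ ->
  (\int[mu]_(t in E) (t `^ (p - 2 * s_lo - 1))%:E <= M1%:E)%E ->
  (\int[mu]_(t in E) (t `^ (p - 2 * s_hi - 1))%:E <= M2%:E)%E ->
  (\int[cmu]_(z in [set z : R | E `|z|%R]) (`|z| `^ p * k z)%:E <=
     (2 * (L1 * M1 + L2 * M2))%:E)%E.
Proof.
move=> mE E0 hM1 hM2.
pose g (t : R) := L1 * t `^ (p - 2 * s_lo - 1) + L2 * t `^ (p - 2 * s_hi - 1).
have mabs : measurable_fun setT (fun z : R => `|z|) by exact: normr_measurable.
have mp c : measurable_fun setT (fun t : R => t `^ c) by exact: measurable_powR.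
have mg : measurable_fun setT g.
  by apply: measurable_funD; apply: measurable_funM => //; exact: measurable_cst.
have g0 t : 0 <= g t by rewrite addr_ge0// mulr_ge0// powR_ge0.
have mA : measurable [set z : R | E `|z|%R].
  by rewrite -[X in measurable X]setTI; exact: mabs.
have mAc : measurable ([set z : R | E `|z|%R] : set (lebesgueType R)).
  exact: sub_caratheodory.
have mgabs : measurable_fun setT (fun z : R => (g `|z|)%:E).
  by apply/measurable_EFinP; apply: measurableT_comp.
have mEc c : measurable_fun E (fun t : R => (t `^ c)%:E).
  by apply/measurable_EFinP; exact: measurable_funTS.
apply: (@le_trans _ _ (\int[cmu]_(z in [set z : R | E `|z|%R]) (g `|z|)%:E)%E).
  apply: ge0_le_integral.
  - exact: mAc.
  - by move=> z _; rewrite lee_fin mulr_ge0 ?powR_ge0 ?ker0_ge0.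
  - apply/measurable_EFinP; apply: measurable_funTS; apply: measurable_funM.
      by apply: (measurable_borel_lebesgue _ _ (fun z : R => `|z| `^ p)); exact: (measurableT_comp (mp p)).
    exact: measurable_ker0.
  - by apply: measurable_funTS; exact: measurable_borel_lebesgue.
  - move=> z /= /E0; rewrite /= in_itv/= andbT => z0.
    rewrite lee_fin.
    have z0' : z != 0 by rewrite -normr_gt0.
    apply: (le_trans (ler_wpM2l (powR_ge0 _ _) (ker0_le z z0'))).
    have e s : p - 2 * s - 1 = p - (1 + 2 * s) by ring.
    rewrite /g !e !powRB ?normr_eq0 ?z0' ?implybT//.
    by rewrite mulrDr [in X in X + _]mulrCA [in X in _ + X]mulrCA.
rewrite (ge0_integral_completed _ (fun z : R => (g `|z|)%:E))//; last 2 first.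
- exact: measurable_funTS.
- by move=> z _; rewrite lee_fin.
have mgE : measurable_fun setT (fun z : R => (g z)%:E) by exact/measurable_EFinP.
rewrite (ge0_integral_even E (fun z : R => (g z)%:E) mE E0 mgE)//.
have -> : (\int[mu]_(z in E) (g z)%:E = L1%:E * \int[mu]_(t in E) (t `^ (p - 2 * s_lo - 1))%:E
    + L2%:E * \int[mu]_(t in E) (t `^ (p - 2 * s_hi - 1))%:E)%E.
  have p0 c z : E z -> (0 <= (z `^ c)%:E :> \bar R)%E by rewrite lee_fin powR_ge0.
  have m c (L : R) : measurable_fun E (fun z : R => L%:E * (z `^ c)%:E)%E.
    exact: measurable_funeM.
  have nn c (L : R) : 0 <= L -> forall z, E z -> (0 <= L%:E * (z `^ c)%:E :> \bar R)%E.
    by move=> L0 z _; rewrite -EFinM lee_fin mulr_ge0// powR_ge0.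
  under eq_integral do rewrite EFinD !EFinM.
  rewrite (ge0_integralD mu mE (nn _ _ hL1) (m _ _) (nn _ _ hL2) (m _ _)).
  rewrite (ge0_integralZl_EFin mu mE (p0 _) (mEc _) hL1).
  by rewrite (ge0_integralZl_EFin mu mE (p0 _) (mEc _) hL2).
have -> : 2 * (L1 * M1 + L2 * M2) = (L1 * M1 + L2 * M2) + (L1 * M1 + L2 * M2) by ring.
rewrite [leRHS]EFinD; apply: leeD; rewrite EFinD !EFinM; apply: leeD;
  by apply: lee_wpmul2l => //; rewrite lee_fin.
Qed.

Lemma integral_ker0_near0 (p r : R) : 2 * s_hi < p -> 0 < r ->
  (\int[cmu]_(z in [set z : R | (`|z| <= r)%R]) (`|z| `^ p * k z)%:E <=
   (2 * (L1 * (r `^ (p - 2 * s_lo) / (p - 2 * s_lo)) +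
         L2 * (r `^ (p - 2 * s_hi) / (p - 2 * s_hi))))%:E)%E.
Proof.
move=> hp r0.
have -> : (\int[cmu]_(z in [set z : R | (`|z| <= r)%R]) (`|z| `^ p * k z)%:E =
    \int[cmu]_(z in [set z : R | `]0%R, r]%classic `|z|%R]) (`|z| `^ p * k z)%:E)%E.
  rewrite integral_mkcond [RHS]integral_mkcond; apply: eq_integral => z _.
  rewrite !patchE; have [->|z0] := eqVneq z 0.
    by rewrite ker00 mulr0; case: ifP; case: ifP.
  congr (if _ then _ else _); apply/idP/idP; rewrite !inE/= !in_itv/= ?normr_gt0 ?z0//.
apply: ge0_integral_ker0_le.
- exact: measurable_itv.
- by move=> t; rewrite /= !in_itv/= => /andP[->].
- by apply: integral_powR_near0 => //; move: hs; rewrite subr_gt0; lra.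
- by apply: integral_powR_near0 => //; rewrite subr_gt0; lra.
Qed.

Lemma integral_ker0_nearoo (q r : R) : q < 2 * s_lo -> 0 < r ->
  (\int[cmu]_(z in [set z : R | (r < `|z|)%R]) (`|z| `^ q * k z)%:E <=
   (2 * (L1 * (r `^ (q - 2 * s_lo) / (2 * s_lo - q)) +
         L2 * (r `^ (q - 2 * s_hi) / (2 * s_hi - q))))%:E)%E.
Proof.
move=> hq r0.
have -> : [set z : R | (r < `|z|)%R] = [set z : R | `]r, +oo[%classic `|z|%R].
  by apply/seteqP; split => z /=; rewrite in_itv/= andbT.
have e s : q - 2 * s = - (2 * s - q) by ring.
apply: ge0_integral_ker0_le.
- exact: measurable_itv.
- by move=> t; rewrite /= !in_itv/= !andbT; exact: lt_trans.
- by rewrite e; apply: integral_powR_nearoo => //; move: hs; rewrite subr_gt0; lra.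
- by rewrite e; apply: integral_powR_nearoo => //; move: hs; rewrite subr_gt0; lra.
Qed.

Lemma measurable_gt_norm (r : R) : measurable [set z : R | r < `|z|].
Proof.
have h : measurable_fun setT (fun z : R => `|z|) by exact: normr_measurable.
have -> : [set z : R | r < `|z|] = (fun z : R => `|z|) @^-1` `]r, +oo[%classic.
  by apply/seteqP; split=> z /=; rewrite in_itv/= andbT.
by rewrite -(setTI (_ @^-1` _)); exact: h.
Qed.

Lemma measurable_le_norm (r : R) : measurable [set z : R | `|z| <= r].
Proof.
have -> : [set z : R | `|z| <= r] = ~` [set z : R | r < `|z|].
  by apply/seteqP; split => z /=; rewrite leNgt => /negP.
apply: measurableC; exact: measurable_gt_norm.
Qed.

Lemma measurable_mul_ker0 (f : R -> R) : measurable_fun setT f ->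
  measurable_fun (setT : set T) ((fun z => (f z * k z)%:E) : T -> \bar R).
Proof.
move=> mf; apply/measurable_EFinP; apply: measurable_funM.
  exact: measurable_borel_lebesgue.
exact: measurable_ker0.
Qed.

Lemma measurable_majorant : measurable_fun setT (majorant alpha beta).
Proof.
have mn : measurable_fun setT (fun z : R => `|z|) by exact: normr_measurable.
apply: measurable_fun_ifT.
- by apply: measurable_fun_ler => //; exact: measurable_cst.
- exact: (measurableT_comp (measurable_powR _)).
- exact: (measurableT_comp (measurable_powR _)).
Qed.

Lemma majorant_ge0 z : 0 <= majorant alpha beta z.
Proof. by rewrite /majorant; case: ifP => _; exact: powR_ge0. Qed.

Lemma integrable_majorant :
  cmu.-integrable setT ((fun z => (majorant alpha beta z * k z)%:E) : T -> \bar R).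
Proof.
have mM := measurable_mul_ker0 _ measurable_majorant.
have M0 z : (0 <= (majorant alpha beta z * k z)%:E)%E.
  by rewrite lee_fin mulr_ge0 ?majorant_ge0// ker0_ge0.
apply/integrableP; split; first exact: mM.
have -> : (\int[cmu]_z `|(majorant alpha beta z * k z)%:E| =
           \int[cmu]_z (majorant alpha beta z * k z)%:E)%E.
  by apply: eq_integral => z _; rewrite gee0_abs.
have mA : measurable ([set z : R | `|z| <= 1] : set T).
  apply: sub_caratheodory; exact: measurable_le_norm.
have mB : measurable ([set z : R | 1 < `|z|] : set T).
  apply: sub_caratheodory; exact: measurable_gt_norm.
have -> : [set: T] = ([set z : R | `|z| <= 1] : set T) `|` ([set z : R | 1 < `|z|] : set T).
  by apply/seteqP; split => z //= _; case: (leP `|z| 1) => ?; [left|right].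
rewrite (ge0_integral_setU cmu mA mB); first last.
- by apply/disj_setPS => z [/= z1]; rewrite ltNge z1.
- by move=> z _; exact: M0.
- exact: measurable_funTS mM.
have -> : (\int[cmu]_(z in [set z : R | (`|z| <= 1)%R]) (majorant alpha beta z * k z)%:E =
   \int[cmu]_(z in [set z : R | (`|z| <= 1)%R]) (`|z| `^ (1 + alpha) * k z)%:E)%E.
  by apply: eq_integral => z; rewrite inE/= /majorant => ->.
have -> : (\int[cmu]_(z in [set z : R | (1 < `|z|)%R]) (majorant alpha beta z * k z)%:E =
   \int[cmu]_(z in [set z : R | (1 < `|z|)%R]) (`|z| `^ beta * k z)%:E)%E.
  by apply: eq_integral => z; rewrite inE/= /majorant leNgt => ->.
apply: lte_add_pinfty.
  apply: (@le_lt_trans _ _ _ _ _ (integral_ker0_near0 _ 1 _ _)).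
  - by move: halpha; lra.
  - by [].
  - exact: ltry.
apply: (@le_lt_trans _ _ _ _ _ (integral_ker0_nearoo _ 1 _ _)).
- by move: hs_lo; lra.
- by [].
- exact: ltry.
Qed.

Lemma sdiff_majorant u (M : R) : C1holder alpha u -> growth beta u -> 0 <= M ->
  exists2 C, 0 <= C & forall x z, `|x| <= M -> `|sdiff u x z| <= C * majorant alpha beta z.
Proof.
move=> [du _ hu] [G hG] M0.
have a0 : 0 <= alpha by move: halpha hs_lo hs; lra.
have b0 : 0 <= beta by move: hs_lo; lra.
have [H hH] := hu `[- (M + 1), M + 1]%classic (@segment_compact _ _ _).
have G0 := growth_coef_ge0 _ _ _ _ hG.
exists (`|H| * 2 `^ alpha + 4 * (G * (3 + M) `^ beta)).
  by rewrite addr_ge0// !mulr_ge0// powR_ge0.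
move=> x z xM; rewrite /majorant; case: ifPn => [z1|]; last rewrite -ltNge => z1.
  apply: (@le_trans _ _ (`|H| * 2 `^ alpha * `|z| `^ (1 + alpha))); last first.
    by rewrite ler_wpM2r ?powR_ge0// lerDl !mulr_ge0// powR_ge0.
  apply: sdiff_holder => // y y' yx yx'.
  have inM t : `|t - x| <= `|z| -> `[- (M + 1), M + 1]%classic t.
    move=> tx; rewrite /= in_itv/= -ler_norml.
    have -> : t = x + (t - x) by ring.
    by apply: (le_trans (ler_normD _ _)); apply: lerD => //; exact: le_trans z1.
  apply: (le_trans (hH _ _ (inM _ yx) (inM _ yx'))).
  by rewrite ler_wpM2r ?powR_ge0// ler_norm.
apply: (@le_trans _ _ (4 * (G * (3 + M) `^ beta) * `|z| `^ beta)); last first.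
  by rewrite ler_wpM2r ?powR_ge0// lerDr !mulr_ge0// powR_ge0.
have bd y : `|y| <= M + `|z| -> `|u y| <= G * (3 + M) `^ beta * `|z| `^ beta.
  move=> yz; apply: (le_trans (hG y)); rewrite -mulrA ler_wpM2l//.
  rewrite -powRM//; last by rewrite addr_ge0.
  apply: ge0_ler_powR => //; rewrite ?nnegrE ?addr_ge0 ?mulr_ge0// ?addr_ge0//.
  by nra.
have b1 : `|u x| <= G * (3 + M) `^ beta * `|z| `^ beta by apply: bd; lra.
have b2 : `|u (x + z)| <= G * (3 + M) `^ beta * `|z| `^ beta.
  by apply: bd; apply: (le_trans (ler_normD _ _)); lra.
have b3 : `|u (x - z)| <= G * (3 + M) `^ beta * `|z| `^ beta.
  by apply: bd; apply: (le_trans (ler_normB _ _)); lra.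
move: b1 b2 b3; rewrite -(mulrA 4) /sdiff; set Y := _ * `|z| `^ beta.
by rewrite !ler_norml => /andP[? ?] /andP[? ?] /andP[? ?]; apply/andP; split; lra.
Qed.

Lemma C1holder_continuous u : C1holder alpha u -> continuous u.
Proof.
by move=> [du _ _] y; apply: differentiable_continuous; apply/derivable1_diffP.
Qed.

Lemma integrable_sdiff u x : C1holder alpha u -> growth beta u ->
  cmu.-integrable setT ((fun z => (sdiff u x z * k z)%:E) : T -> \bar R).
Proof.
move=> Cu Gu.
have [C C0 hC] := sdiff_majorant u `|x| Cu Gu (normr_ge0 _).
apply: (@le_integrable _ _ _ _ _ _ _ ((fun z => C%:E * (majorant alpha beta z * k z)%:E)%E : T -> \bar R)).
- exact: measurableT.
- apply: measurable_mul_ker0; apply: continuous_measurable_fun; apply: continuous_sdiff.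
  exact: C1holder_continuous Cu.
- move=> z _; rewrite -EFinM !abse_EFin lee_fin !normrM (ger0_norm C0).
  rewrite (ger0_norm (majorant_ge0 z)) mulrA ler_wpM2r//.
  exact: (hC x z (lexx _)).
- apply: integrableZl; [exact: measurableT|exact: integrable_majorant].
Qed.

Lemma integrable_truncated u x e : 0 < e -> continuous u -> growth beta u ->
  cmu.-integrable ([set z : R | e < `|z|] : set T)
    ((fun z => ((u x - u (x - z)) * k z)%:E) : T -> \bar R).
Proof.
move=> e0 cu [G hG].
have b0 : 0 <= beta by move: hs_lo; lra.
have mA : measurable ([set z : R | e < `|z|] : set T).
  by apply: sub_caratheodory; exact: measurable_gt_norm.
have G0 := growth_coef_ge0 _ _ _ _ hG.
have [C C0 CE] : exists2 C, 0 <= C & C = 2 * (G * ((2 + `|x|) / e + 1) `^ beta).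
  by eexists; last reflexivity; rewrite !mulr_ge0// powR_ge0.
have p0 : 0 <= (2 + `|x|) / e + 1 by rewrite addr_ge0// divr_ge0// ?addr_ge0// ltW.
have bd y z : e < `|z| -> `|y| <= `|x| + `|z| ->
    `|u y| <= G * ((2 + `|x|) / e + 1) `^ beta * `|z| `^ beta.
  move=> ez yz; apply: (le_trans (hG y)); rewrite -mulrA ler_wpM2l//.
  rewrite -powRM//; apply: ge0_ler_powR => //; rewrite ?nnegrE ?addr_ge0 ?mulr_ge0//.
  have h : 2 + `|x| <= (2 + `|x|) / e * `|z|.
    by rewrite -mulrA ler_peMr ?addr_ge0// mulrC ler_pdivlMr// mul1r ltW.
  by rewrite mulrDl mul1r; lra.
apply: (@le_integrable _ _ _ _ _ _ _ ((fun z => C%:E * (`|z| `^ beta * k z)%:E)%E : T -> \bar R)).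
- exact: mA.
- apply: measurable_funTS; apply: measurable_mul_ker0 => //.
  apply: continuous_measurable_fun => z; apply: cvgB; first exact: cvg_cst.
  exact: continuous_decrement.
- move=> z ez; rewrite -EFinM !abse_EFin lee_fin !normrM.
  rewrite (ger0_norm C0) (ger0_norm (powR_ge0 _ _)) mulrA ler_wpM2r//.
  apply: (le_trans (ler_normB _ _)).
  rewrite CE -mulrA mulr_natl mulr2n; apply: lerD.
    by apply: bd => //; rewrite lerDl.
  by apply: bd => //; exact: ler_normB.
- apply: integrableZl; first exact: mA.
  have mf : measurable_fun (setT : set T) ((fun z => (`|z| `^ beta * k z)%:E) : T -> \bar R).
    apply: measurable_mul_ker0 => //.
    apply: (measurableT_comp (measurable_powR _)); exact: normr_measurable.
  apply/integrableP; split; first exact: measurable_funTS mf.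
  have -> : (\int[cmu]_(z in [set z : R | (e < `|z|)%R]) `|(`|z| `^ beta * k z)%:E| =
             \int[cmu]_(z in [set z : R | (e < `|z|)%R]) (`|z| `^ beta * k z)%:E)%E.
    apply: eq_integral => z _; rewrite gee0_abs// lee_fin mulr_ge0 ?powR_ge0//.
    exact: ker0_ge0.
  apply: (@le_lt_trans _ _ _ _ _ (integral_ker0_nearoo _ e _ e0)).
  + by move: hs_lo; lra.
  + exact: ltry.
Qed.

(** The truncated integral equals its image under [z |-> - z], since the kernel is even and the
    truncation symmetric; the average of the two involves a second difference. *)
Lemma truncated_sdiff u x e : 0 < e -> continuous u -> growth beta u ->
  \int[cmu]_(y in [set y : R | e < `|x - y|]) ((u x - u y) * K (x - y)) =
  2^-1 * \int[cmu]_(z in [set z : R | e < `|z|]) (sdiff u x z * k z).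
Proof.
move=> e0 cu Gu.
have mA : measurable ([set z : R | e < `|z|] : set T).
  by apply: sub_caratheodory; exact: measurable_gt_norm.
set A := [set z : R | e < `|z|].
pose f (z : T) := ((u x - u (x - z)) * k z)%:E.
have If : cmu.-integrable (A : set T) f by exact: integrable_truncated.
have mf := measurable_int _ If.
pose g (z : T) := ((u x - u (x + z)) * k z)%:E.
have AN : (fun y : R => (0 - y)%R) @^-1` A = A.
  by apply/seteqP; split=> z; rewrite /A/= sub0r normrN.
have fg : (\int[cmu]_(z in A) f z = \int[cmu]_(z in A) g z)%E.
  rewrite (integral_reflect 0 A f mA mf) AN; apply: eq_integral => z _.
  by rewrite /f /g sub0r opprK (ker0N).
have Ig : cmu.-integrable (A : set T) g.
  apply/integrableP; split.
    apply: measurable_funTS; apply: measurable_mul_ker0 => //.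
    apply: continuous_measurable_fun => z; apply: cvgB; first exact: cvg_cst.
    exact: continuous_increment.
  have mfa : measurable_fun (A : set T) (fun z => `|f z|)%E by exact: measurableT_comp.
  have -> : (\int[cmu]_(z in A) `|g z| = \int[cmu]_(z in A) `|f z|)%E.
    rewrite [RHS](integral_reflect 0 A _ mA mfa) AN; apply: eq_integral => z _.
    by rewrite /f /g sub0r opprK (ker0N).
  by case/integrableP: If.
rewrite /Rintegral.
have -> : (\int[cmu]_(y in [set y : R | (e < `|x - y|)%R]) ((u x - u y) * K (x - y))%:E =
    \int[cmu]_(z in A) f z)%E.
  rewrite (integral_reflect x A f mA mf); apply: eq_integral => y; rewrite inE/= => ey.
  have xy : x - y != 0 by rewrite -normr_gt0 (lt_trans e0).
  by rewrite /f /ker0 (negbTE xy) subKr.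
have -> : (\int[cmu]_(z in A) (sdiff u x z * k z)%:E =
    \int[cmu]_(z in A) f z + \int[cmu]_(z in A) g z)%E.
  rewrite -integralD//; apply: eq_integral => z _; rewrite /f /g -EFinD; congr EFin.
  by rewrite /sdiff; ring.
have fin1 : (\int[cmu]_(z in A) f z)%E \is a fin_num by exact: integrable_fin_num.
rewrite -fg (fineD fin1 fin1); set a := fine _.
rewrite -mulr2n -[X in _ = _ * X]mulr_natl mulKf//.
Qed.

(** The truncations of an absolutely convergent integral converge to it, by dominated
    convergence. *)
Lemma nonlocal_opE u x : C1holder alpha u -> growth beta u ->
  nonlocal_op K u x = 2^-1 * \int[cmu]_z (sdiff u x z * k z).
Proof.
move=> Cu Gu; have cu := C1holder_continuous u Cu.
rewrite /nonlocal_op; apply/cvg_lim => //.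
apply/cvg_at_rightP => e [e0 ecvg].
have -> : (fun n => \int[cmu]_(y in [set y : R | e n < `|x - y|]) ((u x - u y) * K (x - y))) =
    (fun n => 2^-1 * \int[cmu]_(z in [set z : R | e n < `|z|]) (sdiff u x z * k z)).
  by apply/funext => n; exact: truncated_sdiff.
apply: cvgM; first exact: cvg_cst.
pose f (n : nat) := patch (fun=> 0%E) [set z : R | e n < `|z|]
  (fun z => (sdiff u x z * k z)%:E) : T -> \bar R.
pose h (z : T) := (sdiff u x z * k z)%:E.
have Ih : cmu.-integrable setT h by exact: (integrable_sdiff u x Cu Gu).
have mA n : measurable ([set z : R | e n < `|z|] : set T).
  by apply: sub_caratheodory; exact: measurable_gt_norm.
have [] := @dominated_convergence _ T R cmu setT measurableT f h (abse \o h).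
- move=> n; apply/(measurable_restrictT _ (mA n)).1.
  exact: measurable_funTS (measurable_int _ Ih).
- exact: measurable_int Ih.
- apply: aeW => z _; have [->|z0] := eqVneq z 0.
    rewrite /f /h ker00 mulr0; apply: cvg_near_cst; apply: nearW => n.
    by rewrite patchE ker00 mulr0; case: ifP.
  apply: cvg_near_cst.
  have z0' : 0 < `|z : R| by rewrite normr_gt0.
  have : \forall n \near \oo, e n < `|z : R| by exact: (cvgr_lt _ ecvg).
  by apply: filterS => n en; rewrite /f patchE mem_set.
- exact: integrable_abse.
- apply: aeW => z n _; rewrite /f patchE; case: ifP => // _.
  by rewrite abse0 abse_ge0.
move=> _ _ cv.
have -> : (fun n => \int[cmu]_(z in [set z : R | e n < `|z|]) (sdiff u x z * k z)) =
   fine \o (fun n => \int[cmu]_z f n z)%E.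
  by apply/funext => n; rewrite /= /Rintegral integral_mkcond.
apply: fine_cvg; rewrite fineK; last exact: integrable_fin_num.
exact: cv.
Qed.

(** * Maximum principles *)

Lemma continuous_ker0_eq0 (f : R -> R) : continuous f -> (forall z, 0 <= f z) ->
  (\int[cmu]_z (f z * k z)%:E = 0)%E -> forall z, f z = 0.
Proof.
move=> cf f0 If z0; apply/eqP/negPn/negP => fz0.
have fz0' : 0 < f z0 by rewrite lt_neqAle eq_sym fz0 f0.
have mfk : measurable_fun (setT : set T) ((fun z => (f z * k z)%:E) : T -> \bar R).
  apply: measurable_mul_ker0 => //.
  exact: continuous_measurable_fun.
have := (@ae_eq_integral_abs _ T R cmu setT measurableT _ mfk).1.
have -> : (\int[cmu]_z `|(f z * k z)%:E| = \int[cmu]_z (f z * k z)%:E)%E.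
  apply: eq_integral => z _; rewrite gee0_abs// lee_fin mulr_ge0//.
  exact: ker0_ge0.
move=> /(_ If) [N [mN N0 hN]].
have near0 : \forall z \near z0, 0 < f z by exact: (cvgr_gt _ (cf z0)).
have [z [fz zn0 Nz]] := near_not_null _ _ _ mN N0 near0.
apply: Nz; apply: hN => /= /(_ Logic.I) /eqP; apply/negP.
by rewrite eqe gt_eqF// mulr_gt0//; exact: ker0_gt0.
Qed.

(** At a point where [v] reaches its maximum 0, the second differences are nonnegative, so
    that the integral can only be nonpositive if they vanish. *)
Lemma strong_maximum_principle v x0 : continuous v -> (forall x, v x <= 0) -> v x0 = 0 ->
  cmu.-integrable setT ((fun z => (sdiff v x0 z * k z)%:E) : T -> \bar R) ->
  \int[cmu]_z (sdiff v x0 z * k z) <= 0 -> forall x, v x = 0.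
Proof.
move=> cv v0 vx0 Iv Lv.
have sE z : sdiff v x0 z = - v (x0 + z) - v (x0 - z) by rewrite /sdiff vx0; ring.
have s0 z : 0 <= sdiff v x0 z by rewrite sE; have := v0 (x0 + z); have := v0 (x0 - z); lra.
have k0 (z : R) : 0 <= k z by exact: ker0_ge0.
have I0 : (\int[cmu]_z (sdiff v x0 z * k z)%:E = 0)%E.
  have fin : (\int[cmu]_z (sdiff v x0 z * k z)%:E)%E \is a fin_num.
    exact: integrable_fin_num.
  rewrite -(fineK fin); congr EFin; apply/eqP; rewrite eq_le; apply/andP; split => //.
  by apply: fine_ge0; apply: integral_ge0 => z _; rewrite lee_fin mulr_ge0.
have H := continuous_ker0_eq0 _ (continuous_sdiff v x0 cv) s0 I0.
move=> x; have := H (x - x0); rewrite sE (_ : x0 + (x - x0) = x); last by ring.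
by have := v0 x; have := v0 (x0 - (x - x0)); lra.
Qed.

(** At a point where v nearly attains its supremum M, the second difference is
    almost nonnegative, while the Holder bound controls it near the origin uniformly in
    the point; the nonlocal operator is therefore almost nonnegative there. *)
Lemma weak_maximum_principle v (S H c0 : R) : 0 <= H -> 0 < c0 ->
  (forall x, v x <= S) ->
  (forall x z, `|sdiff v x z| <= H * `|z| `^ (1 + alpha)) ->
  (forall x, cmu.-integrable setT ((fun z => (sdiff v x z * k z)%:E) : T -> \bar R)) ->
  (forall x, 0 < v x -> 2^-1 * \int[cmu]_z (sdiff v x z * k z) <= - c0 * v x) ->
  forall x, v x <= 0.
Proof.
move=> H0 c00 vS sv Iv Lv x1; rewrite leNgt; apply/negP => vx1.
have k0 (z : R) : 0 <= k z by exact: ker0_ge0.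
have b0 : 0 <= beta by move: hs_lo; lra.
pose M := sup (range v).
have hsup : has_sup (range v).
  by split; [exists (v x1), x1|exists S => _ [x _ <-]].
have vM x : v x <= M by apply: sup_ubound; [case: hsup|exists x].
have M0 : 0 < M by exact: lt_le_trans (vM x1).
pose d (n : nat) : R := M / 2 / n.+1%:R.
have d0 n : 0 < d n by rewrite !divr_gt0.
have dM n : d n <= M / 2.
  by rewrite /d ler_pdivrMr// ler_peMr ?divr_ge0 ?(ltW M0)// ler1n.
have /choice[y hy] : forall n, exists x, M - d n < v x.
  by move=> n; have [_ [x _ <-] hx] := sup_adherent (d0 n) hsup; exists x.
have vy n : M / 2 < v (y n) by have := hy n; have := dM n; lra.
(* Both terms of the minimum are needed: the first one tends to 0 with d n, the second one is
   integrable against the kernel near the origin. *)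
have sdiff_ge n (z : R) : - Num.min (2 * d n) (H * `|z| `^ (1 + alpha)) <= sdiff v (y n) z.
  have h1 : - (2 * d n) <= sdiff v (y n) z.
    by rewrite /sdiff; have := vM (y n + z); have := vM (y n - z); have := hy n; lra.
  have h2 : - (H * `|z| `^ (1 + alpha)) <= sdiff v (y n) z.
    by have := sv (y n) z; rewrite ler_norml => /andP[].
  by rewrite /Num.min; case: ifP.
have arith (a b q : R) : 2^-1 * a <= - c0 * q -> 0 <= a + b -> M / 2 <= q -> c0 * M <= b.
  by move=> h1 h2 /(ler_wpM2l (ltW c00)) h3; lra.
pose f (n : nat) (z : T) := (Num.min (2 * d n) (H * `|z| `^ (1 + alpha)) * k z)%:E.
have mn : measurable_fun setT (fun z : R => `|z|) by exact: normr_measurable.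
have mf n : measurable_fun setT (f n).
  apply: (measurable_mul_ker0
    (fun z => Num.min (2 * d n) (H * `|z| `^ (1 + alpha)))).
  apply: measurable_minr; first exact: measurable_cst.
  apply: measurable_funM; first exact: measurable_cst.
  exact: (measurableT_comp (measurable_powR _)).
have m0 n (z : R) : 0 <= Num.min (2 * d n) (H * `|z| `^ (1 + alpha)).
  by rewrite le_min !mulr_ge0 ?powR_ge0// ltW.
pose g (z : T) := ((H + M)%:E * (majorant alpha beta z * k z)%:E)%E.
have Ig : cmu.-integrable setT g.
  apply: integrableZl; first exact: measurableT.
  exact: (integrable_majorant).
have fg n z : (`|f n z| <= g z)%E.
  rewrite /f /g -EFinM abse_EFin lee_fin normrM.
  rewrite (ger0_norm (m0 n z)) (ger0_norm (k0 z)) [leRHS]mulrA; apply: ler_wpM2r => //.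
  rewrite /majorant; case: ifPn => [_|]; last rewrite -ltNge => z1.
    rewrite ge_min; apply/orP; right; apply: ler_wpM2r; first exact: powR_ge0.
    by rewrite lerDl ltW.
  rewrite ge_min; apply/orP; left; apply: (@le_trans _ _ M).
    by move: (dM n); lra.
  rewrite -[leLHS]mulr1; apply: ler_pM; rewrite ?(ltW M0)//.
    by rewrite lerDr.
  by rewrite -[leLHS](powRr0 `|z : R|); apply: ler_powR => //; exact: ltW.
have lim0 : {ae cmu, forall z, setT z -> f ^~ z @ \oo --> cst 0%E z}.
  apply: aeW => z _; apply/fine_cvgP; split; first by apply: nearW.
  have dz : (fun n => 2 * d n * k z) @ \oo --> (0 : R).
    have -> : (fun n => 2 * d n * k z) = (fun n => (M * k z) * n.+1%:R^-1).
      by apply/funext => n; rewrite /d; field.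
    rewrite -[X in _ --> X](mulr0 (M * k z)); apply: cvgM; first exact: cvg_cst.
    exact: cvg_harmonic.
  apply: (@squeeze_cvgr _ _ _ _ (cst 0) (fun n => 2 * d n * k z)).
  - apply: nearW => n /=; rewrite mulr_ge0 ?m0//=.
    by rewrite ler_wpM2r// ge_min lexx.
  - exact: cvg_cst.
  - exact: dz.
have [_ _ cvf] := @dominated_convergence _ T R cmu setT measurableT f (cst 0%E) g mf
  (measurable_cst _) lim0 Ig (aeW _ (fun z n _ => fg n z)).
rewrite integral0 in cvf.
have low n : ((c0 * M)%:E <= \int[cmu]_z f n z)%E.
  have If : cmu.-integrable setT (f n).
    by apply: (le_integrable measurableT (mf n) _ Ig) => z _; apply: (le_trans (fg n z)); rewrite lee_abs.
  have vy0 : 0 < v (y n) by apply: lt_trans (vy n); rewrite divr_gt0.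
  have finf : (\int[cmu]_z f n z)%E \is a fin_num by exact: integrable_fin_num.
  rewrite -(fineK finf) lee_fin.
  apply: (arith (\int[cmu]_z (sdiff v (y n) z * k z)) _ (v (y n)) (Lv _ vy0) _ (ltW (vy n))).
  have -> : fine (\int[cmu]_z f n z)%E =
    \int[cmu]_z (Num.min (2 * d n) (H * `|z| `^ (1 + alpha)) * k z) by [].
  rewrite -(RintegralD measurableT (Iv (y n)) If).
  apply: Rintegral_ge0 => z _ /=; rewrite -mulrDl mulr_ge0//.
  by rewrite addrC -lerBlDl sub0r.
have : ((c0 * M)%:E <= 0)%E.
  rewrite -(cvg_lim _ cvf)//; apply: lime_ge; last exact: nearW.
  by apply/cvg_ex; eexists; exact: cvf.
by rewrite lee_fin leNgt mulr_gt0.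
Qed.

Lemma integrable_sdiff_comb (a b x : R) u v :
  C1holder alpha u -> growth beta u -> C1holder alpha v -> growth beta v ->
  cmu.-integrable setT
    ((fun z => (sdiff (fun y => a * u y - b * v y) x z * k z)%:E) : T -> \bar R).
Proof.
move=> Cu Gu Cv Gv.
have Iu := integrable_sdiff u x Cu Gu.
have Iv := integrable_sdiff v x Cv Gv.
have -> : (fun z : T => (sdiff (fun y => a * u y - b * v y) x z * k z)%:E) =
  (fun z : T => a%:E * (sdiff u x z * k z)%:E - b%:E * (sdiff v x z * k z)%:E)%E.
  by apply/funext => z; rewrite sdiff_comb -!EFinM -EFinB; congr EFin; ring.
by apply: (integrableB measurableT); apply: (integrableZl measurableT).
Qed.

Lemma Rintegral_sdiff_comb (a b x : R) u v :
  C1holder alpha u -> growth beta u -> C1holder alpha v -> growth beta v ->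
  2^-1 * \int[cmu]_z (sdiff (fun y => a * u y - b * v y) x z * k z) =
  a * nonlocal_op K u x - b * nonlocal_op K v x.
Proof.
move=> Cu Gu Cv Gv.
have Iu := integrable_sdiff u x Cu Gu.
have Iv := integrable_sdiff v x Cv Gv.
have Iu' := integrableZl measurableT a Iu.
have Iv' := integrableZl measurableT b Iv.
rewrite !(nonlocal_opE)//.
have -> : \int[cmu]_z (sdiff (fun y => a * u y - b * v y) x z * k z) =
  \int[cmu]_z (a * (sdiff u x z * k z) - b * (sdiff v x z * k z)).
  by apply: eq_Rintegral => z _; rewrite sdiff_comb; ring.
rewrite (RintegralB measurableT Iu' Iv') (RintegralZl _ measurableT Iu).
by rewrite (RintegralZl _ measurableT Iv); ring.
Qed.

Lemma growth_bounded u : bounded_fun u -> growth beta u.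
Proof.
move=> [B [_ hB]]; have b0 : 0 <= beta by move: hs_lo; lra.
have hu y : `|u y| <= `|B| + 1.
  by apply: hB => //; rewrite (le_lt_trans (ler_norm B))// ltrDl.
exists (`|B| + 1) => y; apply: (le_trans (hu y)); rewrite ler_peMr ?addr_ge0//.
rewrite -[leLHS](powRr0 (2 + `|y|)); apply: ler_powR => //.
by have := normr_ge0 y; lra.
Qed.

Lemma holder_seminorm_ltyP (g : R -> R) : (holder_seminorm alpha g < +oo)%E ->
  exists2 H, 0 <= H & forall x y, `|g x - g y| <= H * `|x - y| `^ alpha.
Proof.
move=> hg; exists `|fine (holder_seminorm alpha g)| => // x y.
have [->|xy] := eqVneq x y; first by rewrite !subrr normr0 mulr_ge0// powR_ge0.
have p0 : 0 < `|x - y| `^ alpha by rewrite powR_gt0// normr_gt0 subr_eq0.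
rewrite -ler_pdivrMr//.
have : ((`|g x - g y| / `|x - y| `^ alpha)%:E <= holder_seminorm alpha g)%E.
  by apply: ereal_sup_ubound; exists x, y.
move: hg; case: (holder_seminorm alpha g) => //= r _; rewrite lee_fin => /le_trans; apply.
exact: ler_norm.
Qed.

(** The constant [q] is the maximum of the absolute value of the ratio, hence nonnegative, so
    that multiplying the inequality for [w] by [- q] gives that of a subsolution; the sign
    in front of [wt] is free, since [wt] solves an equation. *)
Lemma ratio_constant_bounded (w wt c : R -> R) (c0 R0 : R) :
  C1holder alpha w -> C1holder alpha wt -> bounded_fun w -> bounded_fun wt ->
  (holder_seminorm alpha (derive1 w) < +oo)%E ->
  (holder_seminorm alpha (derive1 wt) < +oo)%E ->
  (forall x, 0 < w x) -> 0 < c0 -> 0 < R0 ->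
  (forall x, x \notin `[- R0, R0] -> c x <= - c0) ->
  (forall x, 0 <= nonlocal_op K w x - c x * w x) ->
  (forall x, nonlocal_op K wt x - c x * wt x = 0) ->
  exists q : R, forall x, wt x / w x = q.
Proof.
move=> Cw Cwt bw bwt /holder_seminorm_ltyP[H H0 hH] /holder_seminorm_ltyP[Ht Ht0 hHt].
move=> w0 c00 R00 hc Lw Lwt.
have a0 : 0 <= alpha by move: halpha hs_lo hs; lra.
have hsd x z : `|sdiff w x z| <= H * 2 `^ alpha * `|z| `^ (1 + alpha).
  by have [dw _ _] := Cw; exact: (sdiff_holder w alpha H x z a0 H0 dw (fun y y' _ _ => hH y y')).
have hsdt x z : `|sdiff wt x z| <= Ht * 2 `^ alpha * `|z| `^ (1 + alpha).
  by have [dwt _ _] := Cwt;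
    exact: (sdiff_holder wt alpha Ht x z a0 Ht0 dwt (fun y y' _ _ => hHt y y')).
have Gw := growth_bounded w bw; have Gwt := growth_bounded wt bwt.
have cw := C1holder_continuous w Cw; have cwt := C1holder_continuous wt Cwt.
have R0N : - R0 <= R0 by lra.
have cs : {within `[- R0, R0], continuous (fun x => `|wt x / w x|)}.
  apply: continuous_subspaceT; apply: continuous_normr => x.
  by apply: cvgM; [exact: cwt|apply: cvgV; [rewrite gt_eqF|exact: cw]].
have [x0 x0R hx0] := EVT_max R0N cs.
pose q := `|wt x0 / w x0|.
have q0 : 0 <= q by exact: normr_ge0.
have [s s1 sq] : exists2 s : R, `|s| = 1 & s * (wt x0 / w x0) = q.
  rewrite /q; have [_|_] := ger0P (wt x0 / w x0).
    by exists 1; rewrite ?normr1 ?mul1r.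
  by exists (-1); rewrite ?normrN1 ?mulN1r.
pose v y := s * wt y - q * w y.
have cv : continuous v.
  by move=> x; apply: cvgB; apply: cvgM; try exact: cvg_cst; [exact: cwt|exact: cw].
have vin x : x \in `[- R0, R0] -> v x <= 0.
  move=> xR; rewrite /v subr_le0 -ler_pdivrMr// -mulrA.
  by apply: le_trans (hx0 x xR); rewrite (le_trans (ler_norm _))// normrM s1 mul1r.
have vx0 : v x0 = 0.
  by rewrite /v -sq; field; rewrite gt_eqF.
have Lv x : 2^-1 * \int[cmu]_z (sdiff v x z * k z) <= c x * v x.
  rewrite /v Rintegral_sdiff_comb//.
  have -> : nonlocal_op K wt x = c x * wt x by apply/eqP; rewrite -subr_eq0 Lwt.
  have : 0 <= q * (nonlocal_op K w x - c x * w x) by rewrite mulr_ge0.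
  lra.
have Iv x := integrable_sdiff_comb s q x wt w Cwt Gwt Cw Gw.
have v0 : forall x, v x <= 0.
  have [B [_ hB]] := bw; have [Bt [_ hBt]] := bwt.
  have hw y : `|w y| <= `|B| + 1.
    by apply: hB => //; rewrite (le_lt_trans (ler_norm B))// ltrDl.
  have hwt y : `|wt y| <= `|Bt| + 1.
    by apply: hBt => //; rewrite (le_lt_trans (ler_norm Bt))// ltrDl.
  apply: (weak_maximum_principle v
    (`|Bt| + 1) (Ht * 2 `^ alpha + q * (H * 2 `^ alpha)) c0) => //.
  - by rewrite addr_ge0 ?mulr_ge0 ?powR_ge0.
  - move=> x; rewrite /v; have : s * wt x <= `|Bt| + 1.
      by rewrite (le_trans (ler_norm _))// normrM s1 mul1r.
    have : 0 <= q * w x by rewrite mulr_ge0// ltW.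
    lra.
  - move=> x z; rewrite /v sdiff_comb (le_trans (ler_normB _ _))// !normrM s1 mul1r.
    rewrite (ger0_norm q0) mulrDl; apply: lerD; first exact: hsdt.
    by rewrite -mulrA; apply: ler_wpM2l => //; exact: hsd.
  - move=> x vx; apply: (le_trans (Lv x)); rewrite ler_wpM2r ?(ltW vx)//.
    by apply: hc; apply/negP => /vin; rewrite leNgt vx.
have vE : forall x, v x = 0.
  apply: (strong_maximum_principle v x0 cv v0 vx0 (Iv x0)).
  have := Lv x0; rewrite vx0 mulr0; lra.
exists (s * q) => x; have := vE x; rewrite /v => /eqP; rewrite subr_eq0 => /eqP e.
have ss : s * s = 1 by rewrite -expr2 -real_normK ?num_real// s1 expr1n.
rewrite -[wt x]mul1r -ss -(mulrA s) e; field; by rewrite gt_eqF.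
Qed.

(** * The energy estimate *)

Lemma measurable_prod_fst f : measurable_fun setT f ->
  measurable_fun setT (fun p : X * T => f p.1).
Proof. by move=> mf; apply: (measurableT_comp mf); exact: measurable_fst. Qed.

Lemma measurable_prod_snd (f : T -> R) : measurable_fun setT f ->
  measurable_fun setT (fun p : X * T => f p.2).
Proof. by move=> mf; apply: (measurableT_comp mf); exact: measurable_snd. Qed.

Lemma measurable_prod_add f : measurable_fun setT f ->
  measurable_fun setT (fun p : X * T => f (p.1 + p.2)).
Proof.
move=> mf; apply: (measurableT_comp mf); apply: measurable_funD.
  by apply: (measurable_prod_fst idfun); exact: measurable_id.
apply: (measurable_prod_snd idfun); by apply: (measurable_borel_lebesgue _ _ idfun); exact: measurable_id.
Qed.

Lemma measurable_prod_sub f : measurable_fun setT f ->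
  measurable_fun setT (fun p : X * T => f (p.1 - p.2)).
Proof.
move=> mf; apply: (measurableT_comp mf); apply: measurable_funB.
  by apply: (measurable_prod_fst idfun); exact: measurable_id.
apply: (measurable_prod_snd idfun); by apply: (measurable_borel_lebesgue _ _ idfun); exact: measurable_id.
Qed.

Lemma integrable_compact_support f g (M : R) : measurable_fun setT f -> continuous g ->
  (forall x, `|x| <= M -> `|f x| <= `|g x|) -> (forall x, M < `|x| -> f x = 0) ->
  mu.-integrable setT (EFin \o f).
Proof.
move=> mf cg fg f0.
have mI : measurable (`[- M, M]%classic : set X) by exact: measurable_itv.
have -> : EFin \o f = (EFin \o f) \_ `[- M, M]%classic.
  apply/funext => x; rewrite patchE; case: ifPn => //.
  rewrite notin_setE/= in_itv/= -ler_norml => /negP; rewrite -ltNge => /f0.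
  by rewrite /= => ->.
apply/(integrable_mkcond _ mI).1; apply: (le_integrable mI _ _ (g := EFin \o g)).
- by apply: measurable_funTS; exact/measurable_EFinP.
- by move=> x; rewrite /= in_itv/= -ler_norml => xM; rewrite lee_fin fg.
- apply: continuous_compact_integrable; first exact: segment_compact.
  exact: continuous_subspaceT.
Qed.

Section tested_equation.
Variables (w s c : R -> R).
Let wt y := s y * w y.
Hypotheses (Cw : C1holder alpha w) (Cwt : C1holder alpha wt).
Hypotheses (Gw : growth beta w) (Gwt : growth beta wt).
Hypothesis cs : continuous s.
Hypothesis w0 : forall x, 0 < w x.
Hypothesis Lw : forall x, 0 <= nonlocal_op K w x - c x * w x.
Hypothesis Lwt : forall x, nonlocal_op K wt x - c x * wt x = 0.
Variables (e : R -> R) (M : R).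
Hypotheses (ce : continuous e) (e0 : forall x, M < `|x| -> e x = 0) (M0 : 0 <= M).

(* F is the equation for the ratio s times the test function e ^ 2 * s, before the integration
   in z; its two terms are combined so that the singularity at z = 0 is integrable. *)
Let P x := e x ^+ 2 * s x * w x.
Let F x z := (P x * sdiff wt x z - P x * s x * sdiff w x z) * k z.

(** The density, with respect to [K z dz dx], of the bilinear form of the ratio [s] paired with
    [e ^ 2 * s]. *)
Definition tested_form (x z : R) : R :=
  w x * w (x + z) * (e x ^+ 2 * s x - e (x + z) ^+ 2 * s (x + z)) * (s x - s (x + z)).

Let cw : continuous w. Proof. exact: C1holder_continuous Cw. Qed.
Let cwt : continuous wt. Proof. exact: C1holder_continuous Cwt. Qed.
Let cP : continuous P.
Proof.
move=> x; apply: cvgM; last exact: cw.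
by apply: cvgM; [apply: cvgM; exact: ce|exact: cs].
Qed.
Let mm f : continuous f -> measurable_fun setT f.
Proof. exact: continuous_measurable_fun. Qed.

Lemma measurable_prod_ker0 (f : X * T -> R) : measurable_fun setT f ->
  measurable_fun setT (fun p : X * T => (f p * k p.2)%:E).
Proof.
move=> mf; apply/measurable_EFinP; apply: measurable_funM => //.
apply: (measurable_prod_snd k); exact: measurable_ker0.
Qed.

Let mF : measurable_fun setT (fun p : X * T => (F p.1 p.2)%:E).
Proof.
have msd f : continuous f -> measurable_fun setT (fun p : X * T => sdiff f p.1 p.2).
  move=> cf; apply: measurable_funB; first apply: measurable_funB.
  - apply: measurable_funM; first exact: measurable_cst.
    by apply: measurable_prod_fst; exact: mm.
  - by apply: measurable_prod_add; exact: mm.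
  - by apply: measurable_prod_sub; exact: mm.
apply: measurable_prod_ker0; apply: measurable_funB; apply: measurable_funM.
- by apply: measurable_prod_fst; exact: mm.
- exact: msd.
- apply: measurable_funM; apply: measurable_prod_fst; exact: mm.
- exact: msd.
Qed.

Let bounded_on_support f : continuous f -> exists2 B, 0 <= B & forall x, `|x| <= M -> `|f x| <= B.
Proof.
move=> cf; have MN : - M <= M by move: M0; lra.
have cnf : {within `[- M, M], continuous (fun x => `|f x|)}.
  by apply: continuous_subspaceT; exact: continuous_normr.
have [x0 _ hx0] := EVT_max MN cnf.
by exists `|f x0| => // x xM; apply: hx0; rewrite in_itv/= -ler_norml.
Qed.

Let IF : ((mu \x cmu)%E).-integrable setT (fun p : X * T => (F p.1 p.2)%:E).
Proof.
have k0 z : 0 <= k z by exact: ker0_ge0.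
have [C1 C10 hC1] := sdiff_majorant wt M Cwt Gwt M0.
have [C2 C20 hC2] := sdiff_majorant w M Cw Gw M0.
have [BP BP0 hBP] := bounded_on_support P cP.
have [Bs Bs0 hBs] := bounded_on_support s cs.
pose C := BP * (C1 + Bs * C2).
have C0 : 0 <= C by rewrite /C mulr_ge0 ?addr_ge0 ?mulr_ge0.
pose J := (\int[cmu]_z (majorant alpha beta z * k z)%:E)%E.
have IM := integrable_majorant.
have maj0 z : (0 <= (majorant alpha beta z * k z)%:E)%E.
  by rewrite lee_fin mulr_ge0// majorant_ge0.
have J0 : (0 <= J)%E by apply: integral_ge0 => z _; exact: maj0.
have Jfin : J \is a fin_num by exact: integrable_fin_num.
have Fle x z : `|F x z| <= C * \1_(`[- M, M]%classic) x * (majorant alpha beta z * k z).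
  have [xM|xM] := leP `|x| M; last first.
    rewrite /F /P e0// expr0n/= !mul0r subr0 mul0r normr0.
    apply: mulr_ge0; last by rewrite -lee_fin; exact: maj0.
    by apply: mulr_ge0 => //; rewrite indicE.
  rewrite indicE mem_set ?mulr1; last by rewrite /= in_itv/= -ler_norml.
  rewrite /F normrM (ger0_norm (k0 z)) mulrA; apply: ler_wpM2r => //.
  rewrite -mulrA -mulrBr normrM /C -mulrA; apply: ler_pM => //; first exact: hBP.
  rewrite mulrDl; apply: (le_trans (ler_normB _ _)); apply: lerD; first exact: hC1.
  by rewrite normrM -mulrA; apply: ler_pM => //; [exact: hBs|exact: hC2].
apply/(integrable12ltyP _ _ mF).
have mI : measurable (`[- M, M]%classic : set X) by exact: measurable_itv.
apply: (@le_lt_trans _ _ (\int[mu]_x ((C * \1_(`[- M, M]%classic) x)%:E * J))%E).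
  apply: ge0_le_integral.
  - exact: measurableT.
  - by move=> x _; apply: integral_ge0 => z _; exact: abse_ge0.
  - have mFa : measurable_fun setT (abse \o (fun p : X * T => (F p.1 p.2)%:E)).
      exact: measurableT_comp.
    by apply: (measurable_fun_fubini_tonelli_F _ mFa) => p; exact: abse_ge0.
  - apply: emeasurable_funM; last exact: measurable_cst.
    apply/measurable_EFinP; apply: measurable_funM; first exact: measurable_cst.
    exact: measurable_indic.
  - move=> x _; rewrite -ge0_integralZl_EFin; first last.
    + by rewrite mulr_ge0.
    + exact: measurable_int IM.
    + by move=> z _; exact: maj0.
    + exact: measurableT.
    apply: ge0_le_integral.
    + exact: measurableT.
    + by move=> z _; exact: abse_ge0.
    + apply: measurableT_comp; first exact: abse_measurable.
      exact: (measurableT_comp mF (pair1_measurable x)).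
    + by apply: measurable_funeM; exact: measurable_int IM.
    + by move=> z _; rewrite -EFinM abse_EFin lee_fin; exact: Fle.
rewrite -(fineK Jfin).
under eq_integral do rewrite -EFinM.
have -> : (\int[mu]_x (C * \1_(`[- M, M]%classic) x * fine J)%:E =
    \int[mu]_x ((C * fine J)%:E * (\1_(`[- M, M]%classic) x)%:E))%E.
  by apply: eq_integral => x _; rewrite -EFinM; congr EFin; ring.
have mi : measurable_fun setT (fun x : X => (\1_(`[- M, M]%classic) x : R)%:E).
  by apply/measurable_EFinP; exact: measurable_indic.
rewrite ge0_integralZl_EFin//; last by rewrite mulr_ge0// fine_ge0.
rewrite integral_indic// setIT -[X in (_ * X)%E]/(mu `[- M, M]%classic) lebesgue_measure_itv/=.
by case: ifP => _; rewrite ?mule0 ?ltry// -EFinB -EFinM ltry.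
Qed.

Let integral_F_le0 x : (\int[cmu]_z (F x z)%:E <= 0)%E.
Proof.
have IFx := integrable_sdiff_comb
  (P x) (P x * s x) x wt w Cwt Gwt Cw Gw.
have RFx := Rintegral_sdiff_comb
  (P x) (P x * s x) x wt w Cwt Gwt Cw Gw.
have -> : (\int[cmu]_z (F x z)%:E =
  \int[cmu]_z (sdiff (fun y => P x * wt y - P x * s x * w y) x z * k z)%:E)%E.
  by apply: eq_integral => z _; rewrite sdiff_comb.
have fin : (\int[cmu]_z (sdiff (fun y => P x * wt y - P x * s x * w y) x z * k z)%:E)%E
    \is a fin_num by exact: integrable_fin_num.
rewrite -(fineK fin) lee_fin.
have h : nonlocal_op K wt x = c x * wt x by apply/eqP; rewrite -subr_eq0 Lwt.
have Ps : 0 <= P x * s x.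
  have -> : P x * s x = (e x * s x) ^+ 2 * w x by rewrite /P; ring.
  by rewrite mulr_ge0 ?sqr_ge0// ltW.
have N2 : P x * nonlocal_op K wt x - P x * s x * nonlocal_op K w x <= 0.
  have -> : P x * nonlocal_op K wt x - P x * s x * nonlocal_op K w x =
      - (P x * s x * (nonlocal_op K w x - c x * w x)) by rewrite h /wt; ring.
  by rewrite oppr_le0 mulr_ge0.
by move: N2; rewrite -RFx /Rintegral pmulr_rle0 ?invr_gt0.
Qed.

Let IG z : mu.-integrable setT (fun x => (tested_form x z)%:E).
Proof.
have cpl f := continuous_translate f z.
have ct : continuous (tested_form ^~ z).
  move=> x; apply: cvgM; last by apply: cvgB; [exact: cs|exact: cpl].
  apply: cvgM; first by apply: cvgM; [exact: cw|exact: cpl].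
  by apply: cvgB; apply: cvgM; [apply: cvgM; exact: ce|exact: cs
    |apply: cvgM; exact: (cpl e)|exact: cpl].
apply: (integrable_compact_support (tested_form ^~ z) (tested_form ^~ z) (M + `|z|)) => //.
  exact: mm.
move=> x xM.
have h1 : M < `|x| by have := normr_ge0 z; move: xM; lra.
have h2 : M < `|x + z| by have := ler_normB (x + z) z; rewrite addrK; move: xM; lra.
rewrite /tested_form (e0 _ h1) (e0 _ h2).
by rewrite expr0n/= !mul0r subr0 mulr0 mul0r.
Qed.

(* the second half of the difference is moved onto the first by the shift x |-> x + z *)
Let integral_F_tested z :
  (\int[mu]_x (F x z)%:E = (k z)%:E * \int[mu]_x (tested_form x z)%:E)%E.
Proof.
have cpl a f := continuous_translate f a.
pose F1 x := P x * ((s x - s (x + z)) * w (x + z)).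
pose F2 x := P x * ((s x - s (x - z)) * w (x - z)).
have cF1 : continuous F1.
  move=> x; apply: cvgM; first exact: cP.
  apply: cvgM; last exact: cpl.
  by apply: cvgB; [exact: cs|exact: cpl].
have cF2 : continuous F2.
  move=> x; apply: cvgM; first exact: cP.
  apply: cvgM; last exact: (cpl (- z)).
  by apply: cvgB; [exact: cs|exact: (cpl (- z))].
have I1 : mu.-integrable setT (EFin \o F1).
  apply: (integrable_compact_support F1 F1 M) => //; first exact: mm.
  by move=> x xM; rewrite /F1 /P e0// expr0n/= !mul0r.
have I2 : mu.-integrable setT (EFin \o F2).
  apply: (integrable_compact_support F2 F2 M) => //; first exact: mm.
  by move=> x xM; rewrite /F2 /P e0// expr0n/= !mul0r.
have cF2' : continuous (fun x => F2 (x + z)) by exact: cpl.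
have I2' : mu.-integrable setT (EFin \o (fun x => F2 (x + z))).
  apply: (integrable_compact_support _ (fun x => F2 (x + z)) (M + `|z|)) => //.
    exact: mm.
  move=> x xM; have h : M < `|x + z|; last by rewrite /F2 /P (e0 _ h) expr0n/= !mul0r.
  by have := ler_normB (x + z) z; rewrite addrK; move: xM; lra.
have -> : (\int[mu]_x (F x z)%:E = \int[mu]_x ((k z)%:E * ((F1 x)%:E + (F2 x)%:E)))%E.
  apply: eq_integral => x _; rewrite -EFinD -EFinM; congr EFin.
  by rewrite /F /F1 /F2 /sdiff /wt; ring.
have IF12 := integrableD measurableT I1 I2.
rewrite (integralZl measurableT IF12 (k z)); congr (_ * _)%E.
rewrite (integralD measurableT I1 I2).
have m2 : measurable_fun setT (EFin \o F2) by exact: measurable_int I2.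
rewrite -(integral_shift z _ m2) -(integralD measurableT I1 I2').
apply: eq_integral => x _ /=; rewrite -EFinD; congr EFin.
by rewrite /F1 /F2 /tested_form /P addrK; ring.
Qed.

(** For fixed [x] the integral of [F x] over [z] has a sign, by the equation and the
    inequality; for fixed [z] the integral over [x] is that of the bilinear form.  Fubini
    exchanges the two. *)
Lemma tested_form_le0 :
  [/\ forall z, mu.-integrable setT (fun x => (tested_form x z)%:E),
      cmu.-integrable setT ((fun z => (k z)%:E * \int[mu]_x (tested_form x z)%:E)%E : T -> \bar R) &
      (\int[cmu]_z ((k z)%:E * \int[mu]_x (tested_form x z)%:E) <= 0)%E].
Proof.
have E : (fun z : T => ((k z)%:E * \int[mu]_x (tested_form x z)%:E)%E) =
    (fun z : T => (\int[mu]_x (F x z)%:E)%E).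
  by apply/funext => z; rewrite integral_F_tested.
split; first exact: IG.
  have mG : measurable_fun setT (fun z : T => (\int[mu]_x (F x z)%:E)%E).
    exact: (measurable_fubini_G IF).
  have mFa : measurable_fun setT (abse \o (fun p : X * T => (F p.1 p.2)%:E)).
    exact: measurableT_comp.
  rewrite E; apply/integrableP; split; first exact: mG.
  apply: le_lt_trans ((integrable21ltyP mu cmu mF).1 IF).
  apply: ge0_le_integral.
  - exact: measurableT.
  - by move=> z _; exact: abse_ge0.
  - exact: measurableT_comp.
  - by apply: (measurable_fun_fubini_tonelli_G _ mFa) => p; exact: abse_ge0.
  - move=> z _; apply: le_abse_integral; first exact: measurableT.
    exact: (measurableT_comp mF (pair2_measurable z)).
have -> : (\int[cmu]_z ((k z)%:E * \int[mu]_x (tested_form x z)%:E) =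
    \int[cmu]_z \int[mu]_x (F x z)%:E)%E.
  by apply: eq_integral => z _; rewrite integral_F_tested.
rewrite -(Fubini IF) -[leRHS](integral0 mu setT).
apply: le_integral => //.
- exact: (integrable_fubini_F IF).
- exact: integrable0.
- by move=> x _; exact: integral_F_le0.
Qed.

(** The form in which the equation is used: a pointwise inequality modulo the tested form
    becomes an inequality between integrals.  The tested form may fail to be integrable
    in both variables together, but its integral in [x] is integrable in [z], hence the
    order of integration in the proof. *)
Lemma energy_inequality (q r : R -> R -> R) :
  (forall x z, 0 <= q x z) -> (forall x z, 0 <= r x z) ->
  measurable_fun setT (fun p : X * T => q p.1 p.2) ->
  measurable_fun setT (fun p : X * T => r p.1 p.2) ->
  (forall x z, q x z <= tested_form x z + r x z) ->
  (forall z, mu.-integrable setT (fun x => (r x z)%:E)) ->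
  (\int[mu \x cmu]_p (q p.1 p.2 * k p.2)%:E <= \int[mu \x cmu]_p (r p.1 p.2 * k p.2)%:E)%E.
Proof.
move=> q0 r0 mq mr qr Ir.
have k0 (z : R) : 0 <= k z by exact: ker0_ge0.
have mqk := measurable_prod_ker0 _ mq; have mrk := measurable_prod_ker0 _ mr.
have qk0 (p : X * T) : (0 <= (q p.1 p.2 * k p.2)%:E)%E by rewrite lee_fin mulr_ge0.
have rk0 (p : X * T) : (0 <= (r p.1 p.2 * k p.2)%:E)%E by rewrite lee_fin mulr_ge0.
have [IG' Ig g0] := tested_form_le0.
pose g (z : T) := ((k z)%:E * \int[mu]_x (tested_form x z)%:E)%E.
pose h (z : T) := (\int[mu]_x (r x z * k z)%:E)%E.
have mh : measurable_fun setT h by exact: (measurable_fun_fubini_tonelli_G _ mrk rk0).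
have h0 z : (0 <= h z)%E by apply: integral_ge0 => x _; exact: (rk0 (x, z)).
rewrite (fubini_tonelli2 _ mqk qk0) (fubini_tonelli2 _ mrk rk0).
change ((\int[cmu]_z (\int[mu]_x (q x z * k z)%:E) <= \int[cmu]_z h z)%E).
have [->|hfin] := eqVneq (\int[cmu]_z h z)%E +oo%E; first exact: leey.
have Ih : cmu.-integrable setT h.
  apply/integrableP; split; first exact: mh.
  have -> : (\int[cmu]_z `|h z| = \int[cmu]_z h z)%E.
    by apply: eq_integral => z _; rewrite gee0_abs.
  by rewrite ltey.
apply: (@le_trans _ _ (\int[cmu]_z (g z + h z))%E); last first.
  by rewrite (integralD measurableT Ig Ih) -[leRHS]add0e leeD2r.
apply: ge0_le_integral.
- exact: measurableT.
- by move=> z _; apply: integral_ge0 => x _; exact: (qk0 (x, z)).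
- exact: (measurable_fun_fubini_tonelli_G _ mqk qk0).
- by apply: emeasurable_funD; [exact: measurable_int Ig|exact: mh].
- move=> z _; rewrite /g /h.
  have Ik : mu.-integrable setT (fun x => ((k z)%:E * (tested_form x z)%:E)%E).
    exact: (integrableZl measurableT).
  have Irk : mu.-integrable setT (fun x => ((k z)%:E * (r x z)%:E)%E).
    exact: (integrableZl measurableT).
  rewrite -(integralZl measurableT (IG' z)).
  have -> : (\int[mu]_x (r x z * k z)%:E = \int[mu]_x ((k z)%:E * (r x z)%:E))%E.
    by apply: eq_integral => x _; rewrite -EFinM mulrC.
  rewrite -(integralD measurableT Ik Irk).
  apply: le_integral.
  + exact: measurableT.
  + apply: (le_integrable measurableT _ _ (integrableD measurableT Ik Irk)).
      exact: (measurableT_comp mqk (pair2_measurable z)).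
    move=> x _ /=; rewrite lee_fin -mulrDr !ger0_norm ?mulr_ge0//.
      by rewrite mulrC ler_wpM2l.
    by apply: le_trans (qr x z).
  + exact: integrableD.
  + by move=> x _; rewrite -!EFinM -EFinD lee_fin -mulrDr mulrC ler_wpM2l.
Qed.

End tested_equation.

(** Up to constants, the maximum of the squared growth over two points at distance [|z|] near the
    ball of radius [r], multiplied by the squared increment [min (1, |z| / r) ^ 2] of
    the cutoff at scale [r]. *)
Definition near_far (r z : R) : R :=
  if `|z| <= r then `|z| `^ 2 * r `^ (2 * beta - 2) else `|z| `^ (2 * beta).

Lemma near_far_ge0 r z : 0 <= near_far r z.
Proof. by rewrite /near_far; case: ifP => _; rewrite ?mulr_ge0 ?powR_ge0. Qed.

Lemma measurable_near_far r : measurable_fun setT (near_far r).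
Proof.
have mn : measurable_fun setT (fun z : R => `|z|) by exact: normr_measurable.
apply: measurable_fun_ifT.
- by apply: measurable_fun_ler => //; exact: measurable_cst.
- apply: measurable_funM; last exact: measurable_cst.
  exact: (measurableT_comp (measurable_powR _)).
- exact: (measurableT_comp (measurable_powR _)).
Qed.

Lemma mulr_powR_le1 (r a b : R) : 1 <= r -> 1 + a + b <= 0 -> r * (r `^ a * r `^ b) <= 1.
Proof.
move=> r1 ab; have r0 : r != 0 by rewrite gt_eqF// (lt_le_trans ltr01).
have -> : r * (r `^ a * r `^ b) = r `^ (1 + a + b).
  rewrite !powRD ?r0 ?implybT// powRr1 ?mulrA//; exact: le_trans r1.
by rewrite -[leRHS](powRr0 r); apply: ler_powR.
Qed.

(** The critical scaling: the growth r ^ (2 s_lo - 1) of the square of the solution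
    compensates exactly the decay of the energy of a cutoff at scale r. *)
Lemma integral_near_far : exists2 C0 : R, 0 <= C0 & forall r, 1 <= r ->
  (\int[cmu]_z (r * (near_far r z * k z))%:E <= C0%:E)%E.
Proof.
pose B1 := 2 * (L1 / (2 - 2 * s_lo) + L2 / (2 - 2 * s_hi)).
pose B2 := 2 * (L1 / (2 * s_lo - 2 * beta) + L2 / (2 * s_hi - 2 * beta)).
have i1 : 0 < (2 - 2 * s_lo)^-1 by rewrite invr_gt0; move: hs hs_hi; lra.
have i2 : 0 < (2 - 2 * s_hi)^-1 by rewrite invr_gt0; move: hs hs_hi; lra.
have i3 : 0 < (2 * s_lo - 2 * beta)^-1 by rewrite invr_gt0; move: hs hs_hi; lra.
have i4 : 0 < (2 * s_hi - 2 * beta)^-1 by rewrite invr_gt0; move: hs hs_hi; lra.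
exists (B1 + B2).
  by rewrite /B1 /B2 addr_ge0// mulr_ge0// addr_ge0// mulr_ge0// ltW.
move=> r r1.
have r0 : 0 < r by apply: lt_le_trans r1.
have k0 (z : R) : 0 <= k z by exact: ker0_ge0.
have mN : measurable_fun (setT : set T) ((fun z => (near_far r z * k z)%:E) : T -> \bar R).
  exact: (measurable_mul_ker0 _ (measurable_near_far r)).
have N0 z : (0 <= (near_far r z * k z)%:E)%E.
  by rewrite lee_fin mulr_ge0// near_far_ge0.
have mA : measurable ([set z : R | `|z| <= r] : set T).
  by apply: sub_caratheodory; exact: measurable_le_norm.
have mB : measurable ([set z : R | r < `|z|] : set T).
  by apply: sub_caratheodory; exact: measurable_gt_norm.
have -> : (\int[cmu]_z (r * (near_far r z * k z))%:E =
   r%:E * \int[cmu]_z (near_far r z * k z)%:E)%E.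
  rewrite -ge0_integralZl_EFin; first by apply: eq_integral => z _; rewrite EFinM.
  - exact: measurableT.
  - by move=> z _.
  - exact: mN.
  - exact: ltW.
have -> : [set: T] = ([set z : R | `|z| <= r] : set T) `|` ([set z : R | r < `|z|] : set T).
  by apply/seteqP; split => z //= _; case: (leP `|z| r) => ?; [left|right].
rewrite (ge0_integral_setU cmu mA mB); first last.
- by apply/disj_setPS => z [/= z1]; rewrite ltNge z1.
- by move=> z _; exact: N0.
- exact: measurable_funTS mN.
have -> : (\int[cmu]_(z in [set z : R | (`|z| <= r)%R]) (near_far r z * k z)%:E =
   (r `^ (2 * beta - 2))%:E * \int[cmu]_(z in [set z : R | (`|z| <= r)%R]) (`|z| `^ 2 * k z)%:E)%E.
  rewrite -ge0_integralZl_EFin.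
  - apply: eq_integral => z; rewrite inE/= /near_far => ->.
    by rewrite -EFinM; congr EFin; ring.
  - exact: mA.
  - by move=> z _; rewrite lee_fin mulr_ge0// powR_ge0.
  - apply: measurable_funTS; apply: (measurable_mul_ker0 (fun z => `|z| `^ 2)).
    apply: (measurableT_comp (measurable_powR _)); exact: normr_measurable.
  - exact: powR_ge0.
have -> : (\int[cmu]_(z in [set z : R | (r < `|z|)%R]) (near_far r z * k z)%:E =
   \int[cmu]_(z in [set z : R | (r < `|z|)%R]) (`|z| `^ (2 * beta) * k z)%:E)%E.
  by apply: eq_integral => z; rewrite inE/= /near_far leNgt => ->.
have hp : 2 * s_hi < 2 by move: hs_hi; lra.
have hq : 2 * beta < 2 * s_lo by lra.
have h1 := integral_ker0_near0 2 r hp r0.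
have h2 := integral_ker0_nearoo (2 * beta) r hq r0.
apply: le_trans.
  apply: lee_wpmul2l; first by rewrite lee_fin ltW.
  apply: leeD; last exact: h2.
  apply: lee_wpmul2l; last exact: h1.
  by rewrite lee_fin powR_ge0.
rewrite -(EFinM (r `^ (2 * beta - 2))) -EFinD -EFinM lee_fin.
have p1 : r * (r `^ (2 * beta - 2) * r `^ (2 - 2 * s_lo)) <= 1.
  by apply: mulr_powR_le1 => //; lra.
have p2 : r * (r `^ (2 * beta - 2) * r `^ (2 - 2 * s_hi)) <= 1.
  by apply: mulr_powR_le1 => //; move: hs; lra.
have p3 : r * (r `^ (2 * beta - 2 * s_lo) * r `^ 0) <= 1.
  by apply: mulr_powR_le1 => //; lra.
have p4 : r * (r `^ (2 * beta - 2 * s_hi) * r `^ 0) <= 1.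
  by apply: mulr_powR_le1 => //; move: hs; lra.
move: p1 p2 p3 p4; rewrite powRr0 !mulr1 /B1 /B2.
move: i1 i2 i3 i4.
move: (2 - 2 * s_lo)^-1 (2 - 2 * s_hi)^-1 (2 * s_lo - 2 * beta)^-1 (2 * s_hi - 2 * beta)^-1.
move: (r `^ (2 * beta - 2)) (r `^ (2 - 2 * s_lo)) (r `^ (2 - 2 * s_hi)).
move: (r `^ (2 * beta - 2 * s_lo)) (r `^ (2 * beta - 2 * s_hi)).
move=> a b d e1 e2 j1 j2 j3 j4 J1 J2 J3 J4 p1 p2 p3 p4.
have q1 := ler_wpM2l (mulr_ge0 hL1 (ltW J1)) p1.
have q2 := ler_wpM2l (mulr_ge0 hL2 (ltW J2)) p2.
have q3 := ler_wpM2l (mulr_ge0 hL1 (ltW J3)) p3.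
have q4 := ler_wpM2l (mulr_ge0 hL2 (ltW J4)) p4.
move: q1 q2 q3 q4; rewrite !mulr1; lra.
Qed.

Section cutoff_energy.
Variables (w s : R -> R) (C D : R).
Hypotheses (cw : continuous w) (cs : continuous s).
Hypothesis w0 : forall x, 0 < w x.
Hypothesis wC : forall x, w x <= C.
Hypothesis sD : forall y, `|s y| <= D * (2 + `|y|) `^ beta.

Definition cutoff_energy (r x z : R) : R :=
  (cutoff r x - cutoff r (x + z)) ^+ 2 * (s x + s (x + z)) ^+ 2 * (w x * w (x + z)).

(** The energy density of the cutoff vanishes unless one of the two points is in the support;
    keeping the two possibilities as a sum allows each to be integrated in [x] separately,
    with the same result after a translation. *)
Lemma cutoff_energy_le (r x z : R) : 1 <= r ->
  cutoff_energy r x z <= (\1_(`[- (2 * r), 2 * r]%classic) x + \1_(`[- (2 * r), 2 * r]%classic) (x + z)) *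
    ((C * (2 * (D * 5 `^ beta))) ^+ 2 * near_far r z).
Proof.
move=> r1; have r0 : 0 < r by apply: lt_le_trans r1.
have b0 : 0 <= beta by move: hs_lo; lra.
have D0 := growth_coef_ge0 _ _ _ _ sD.
have C0 : 0 <= C by exact: le_trans (ltW (w0 0)) (wC 0).
have nf0 : 0 <= (C * (2 * (D * 5 `^ beta))) ^+ 2 * near_far r z.
  by rewrite mulr_ge0 ?sqr_ge0 ?near_far_ge0.
have ind0 y : 0 <= \1_(`[- (2 * r), 2 * r]%classic) y :> R by rewrite indicE.
have ind1 y : `|y| <= 2 * r -> \1_(`[- (2 * r), 2 * r]%classic) y = 1 :> R.
  by move=> yr; rewrite indicE mem_set//= in_itv/= -ler_norml.
have [[xr xzr]|xr] : (2 * r < `|x| /\ 2 * r < `|x + z|) \/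
    (`|x| <= 2 * r + `|z| /\ `|x + z| <= 2 * r + `|z| /\
     1 <= \1_(`[- (2 * r), 2 * r]%classic) x + \1_(`[- (2 * r), 2 * r]%classic) (x + z) :> R).
  have [xr|xr] := leP `|x| (2 * r).
    right; split; first by rewrite (le_trans xr)// lerDl.
    split; first by rewrite (le_trans (ler_normD _ _))// lerD2r.
    by rewrite ind1// lerDl.
  have [xzr|xzr] := leP `|x + z| (2 * r); last by left.
  right; split.
    by have := ler_normB (x + z) z; rewrite addrK; move: xzr; lra.
  split; first by rewrite (le_trans xzr)// lerDl.
  by rewrite (ind1 (x + z))// lerDr.
- rewrite /cutoff_energy !cutoff_out// subrr expr0n/= !mul0r.
  by rewrite mulr_ge0// addr_ge0.
case: xr => xr [xzr one].
apply: (@le_trans _ _ ((C * (2 * (D * 5 `^ beta))) ^+ 2 * near_far r z)); last first.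
  by rewrite ler_peMl.
pose m := Num.max r `|z|.
have m0 : 0 <= m by rewrite /m le_max ltW.
have sm y : `|y| <= 2 * r + `|z| -> `|s y| <= D * 5 `^ beta * m `^ beta.
  move=> yr; apply: (le_trans (sD y)); rewrite -mulrA ler_wpM2l//.
  rewrite -powRM//; apply: ge0_ler_powR => //; rewrite ?nnegrE ?addr_ge0 ?mulr_ge0//.
  have : r <= m by rewrite /m le_max lexx.
  have : `|z| <= m by rewrite /m le_max lexx orbT.
  lra.
have hsum : (s x + s (x + z)) ^+ 2 <= (2 * (D * 5 `^ beta)) ^+ 2 * m `^ (2 * beta).
  rewrite mulrC (mulrC 2 beta) (powRrM m beta 2) powR_mulrn ?powR_ge0// -exprMn.
  rewrite -[leLHS]real_normK ?num_real// lerXn2r ?nnegrE// ?mulr_ge0 ?powR_ge0//.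
  by apply: (le_trans (ler_normD _ _)); have := sm x xr; have := sm _ xzr; lra.
have hww : w x * w (x + z) <= C ^+ 2.
  by rewrite expr2; apply: ler_pM => //; exact: ltW.
have hcut : (cutoff r x - cutoff r (x + z)) ^+ 2 * m `^ (2 * beta) <= near_far r z.
  rewrite /near_far /m; case: ifPn => [zr|]; last rewrite -ltNge => zr.
    rewrite max_l//.
    have -> : `|z| `^ 2 * r `^ (2 * beta - 2) = (`|z| / r) ^+ 2 * r `^ (2 * beta).
      rewrite powRB ?(gt_eqF r0) ?implybT// !powR_mulrn ?(ltW r0)//.
      by rewrite exprMn exprVn; ring.
    rewrite ler_wpM2r ?powR_ge0// -[leLHS]real_normK ?num_real// lerXn2r ?nnegrE ?divr_ge0 ?(ltW r0)//.
    by have := cutoff_lip r x (x + z) r0; rewrite opprD addrA subrr sub0r normrN.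
  rewrite max_r ?(ltW zr)// ler_piMl ?powR_ge0//.
  have := cutoff_ge0 r x; have := cutoff_le1 r x.
  have := cutoff_ge0 r (x + z); have := cutoff_le1 r (x + z); nra.
have -> : (C * (2 * (D * 5 `^ beta))) ^+ 2 * near_far r z =
  near_far r z * (2 * (D * 5 `^ beta)) ^+ 2 * C ^+ 2 by rewrite exprMn; ring.
rewrite /cutoff_energy; apply: ler_pM; last exact: hww.
- by apply: mulr_ge0; exact: sqr_ge0.
- by apply: mulr_ge0; exact: ltW.
apply: (@le_trans _ _ ((cutoff r x - cutoff r (x + z)) ^+ 2 *
  ((2 * (D * 5 `^ beta)) ^+ 2 * m `^ (2 * beta)))).
  by apply: ler_wpM2l; [exact: sqr_ge0|exact: hsum].
have -> : (cutoff r x - cutoff r (x + z)) ^+ 2 * ((2 * (D * 5 `^ beta)) ^+ 2 * m `^ (2 * beta)) =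
  ((cutoff r x - cutoff r (x + z)) ^+ 2 * m `^ (2 * beta)) * (2 * (D * 5 `^ beta)) ^+ 2 by ring.
by rewrite ler_wpM2r ?sqr_ge0.
Qed.

End cutoff_energy.

Section liouville.
Variables (w s c : R -> R) (C D : R).
Hypotheses (Cw : C1holder alpha w) (Cwt : C1holder alpha (fun y => s y * w y)).
Hypotheses (Gw : growth beta w) (Gwt : growth beta (fun y => s y * w y)).
Hypothesis cs : continuous s.
Hypothesis w0 : forall x, 0 < w x.
Hypothesis wC : forall x, w x <= C.
Hypothesis sD : forall y, `|s y| <= D * (2 + `|y|) `^ beta.
Hypothesis Lw : forall x, 0 <= nonlocal_op K w x - c x * w x.
Hypothesis Lwt : forall x, nonlocal_op K (fun y => s y * w y) x - c x * (s x * w x) = 0.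

(* W is the energy density of s, I n its localisation, E n the energy density of the cutoff,
   and Tl n the part of W where the cutoff is not constant. *)
Let e (n : nat) := cutoff (n.+1%:R : R).
Let W x z := (s x - s (x + z)) ^+ 2 * (w x * w (x + z)).
Let I n x z := 4^-1 * ((e n x ^+ 2 + e n (x + z) ^+ 2) * W x z).
Let E n x z := cutoff_energy w s n.+1%:R x z.
Let Tl n x z := (e n x != e n (x + z))%:R * W x z.
Let dbl (f : R -> R -> R) := (\int[mu \x cmu]_p (f p.1 p.2 * k p.2)%:E)%E.

Let cw : continuous w. Proof. exact: C1holder_continuous Cw. Qed.
Let k0 (z : R) : 0 <= k z. Proof. exact: ker0_ge0. Qed.
Let ww0 x z : 0 <= w x * w (x + z). Proof. by rewrite mulr_ge0// ltW. Qed.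
Let W0 x z : 0 <= W x z. Proof. by rewrite mulr_ge0 ?sqr_ge0. Qed.
Let I0 n x z : 0 <= I n x z.
Proof. by rewrite /I mulr_ge0// mulr_ge0// addr_ge0// sqr_ge0. Qed.
Let E0 n x z : 0 <= E n x z.
Proof. by rewrite /E /cutoff_energy mulr_ge0// mulr_ge0// sqr_ge0. Qed.
Let Tl0 n x z : 0 <= Tl n x z. Proof. by rewrite /Tl mulr_ge0. Qed.

Let mfst f : continuous f -> measurable_fun setT (fun p : X * T => f p.1 : R).
Proof. by move=> cf; apply: measurable_prod_fst; exact: continuous_measurable_fun. Qed.
Let madd f : continuous f -> measurable_fun setT (fun p : X * T => f (p.1 + p.2) : R).
Proof. by move=> cf; apply: measurable_prod_add; exact: continuous_measurable_fun. Qed.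
Let msqr (f : X * T -> R) : measurable_fun setT f -> measurable_fun setT (fun p => f p ^+ 2).
Proof. by move=> mf; apply: measurable_funX. Qed.

Let mW : measurable_fun setT (fun p : X * T => W p.1 p.2).
Proof.
apply: measurable_funM; last by apply: measurable_funM; [exact: mfst|exact: madd].
by apply: msqr; apply: measurable_funB; [exact: mfst|exact: madd].
Qed.

Let ce n : continuous (e n). Proof. exact: continuous_cutoff. Qed.

Let mI n : measurable_fun setT (fun p : X * T => I n p.1 p.2).
Proof.
apply: measurable_funM; first exact: measurable_cst.
apply: measurable_funM; last exact: mW.
by apply: measurable_funD; apply: msqr; [apply: mfst; exact: ce|apply: madd; exact: ce].
Qed.

Let mE n : measurable_fun setT (fun p : X * T => E n p.1 p.2).
Proof.
apply: measurable_funM; last by apply: measurable_funM; [exact: mfst|exact: madd].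
apply: measurable_funM; apply: msqr.
  by apply: measurable_funB; [apply: mfst|apply: madd]; exact: ce.
by apply: measurable_funD; [exact: mfst|exact: madd].
Qed.

Let mTl n : measurable_fun setT (fun p : X * T => Tl n p.1 p.2).
Proof.
apply: measurable_funM; last exact: mW.
have -> : (fun p : X * T => (e n p.1 != e n (p.1 + p.2))%:R : R) =
  (fun p => if e n p.1 == e n (p.1 + p.2) then 0 else 1).
  by apply/funext => p; case: eqP.
apply: measurable_fun_ifT; [|exact: measurable_cst..].
apply: measurable_fun_eqr; [apply: mfst|apply: madd]; exact: ce.
Qed.

Let nk (f : R -> R -> R) : (forall x z, 0 <= f x z) -> forall p : X * T, (0 <= (f p.1 p.2 * k p.2)%:E :> \bar R)%E.
Proof. by move=> f0 p; rewrite lee_fin mulr_ge0. Qed.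

Let mk (f : R -> R -> R) : measurable_fun setT (fun p : X * T => f p.1 p.2) ->
  measurable_fun setT (fun p : X * T => (f p.1 p.2 * k p.2)%:E).
Proof. exact: (measurable_prod_ker0). Qed.

Let energy_bound : exists2 B : R, 0 <= B & forall n, (dbl (E n) <= B%:E)%E.
Proof.
have [C0 C00 hC0] := integral_near_far.
have [C1 C10 C1E] : exists2 C1, 0 <= C1 & C1 = (C * (2 * (D * 5 `^ beta))) ^+ 2.
  by exists ((C * (2 * (D * 5 `^ beta))) ^+ 2); first exact: sqr_ge0.
exists (8 * C1 * C0); first by rewrite !mulr_ge0.
move=> n; pose r : R := n.+1%:R.
have r1 : 1 <= r by rewrite ler1n.
have r0 : 0 < r by apply: lt_le_trans r1.
rewrite /dbl (fubini_tonelli2 _ (mk _ (mE n)) (nk _ (E0 n))).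
pose A : set R := `[- (2 * r), 2 * r]%classic.
have mA : measurable (A : set X) by exact: measurable_itv.
have m1 : measurable_fun setT (fun x : X => (\1_A x : R)%:E).
  by apply/measurable_EFinP; exact: measurable_indic.
have muA : (\int[mu]_x (\1_A x : R)%:E = (4 * r)%:E)%E.
  rewrite integral_indic// setIT -[LHS]/(mu `[- (2 * r), 2 * r]%classic).
  rewrite lebesgue_measure_itv/= lte_fin ifT; last by move: r0; lra.
  by rewrite -EFinB; congr EFin; ring.
have i0 x : (0 <= (\1_A x : R)%:E)%E by rewrite lee_fin indicE.
have muA' z : (\int[mu]_x (\1_A (x + z)%R : R)%:E = (4 * r)%:E)%E.
  by rewrite (integral_shift z (fun x => (\1_A x : R)%:E) m1).
apply: (@le_trans _ _ (\int[cmu]_z ((8 * C1)%:E * (r * (near_far r z * k z))%:E))%E).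
  apply: ge0_le_integral.
  - exact: measurableT.
  - by move=> z _; apply: integral_ge0 => x _; exact: (nk _ (E0 n) (x, z)).
  - exact: (measurable_fun_fubini_tonelli_G _ (mk _ (mE n)) (nk _ (E0 n))).
  - apply: measurable_funeM; apply/measurable_EFinP; apply: measurable_funM.
      exact: measurable_cst.
    apply: measurable_funM.
      exact: (measurable_borel_lebesgue _ _ _ (measurable_near_far r)).
    exact: measurable_ker0.
  - move=> z _; pose h := C1 * near_far r z * k z.
    have h0 : 0 <= h by rewrite !mulr_ge0// near_far_ge0.
    apply: (@le_trans _ _ (\int[mu]_x (h%:E * ((\1_A x : R)%:E + (\1_A (x + z)%R : R)%:E)))%E).
      apply: ge0_le_integral.
      + exact: measurableT.
      + by move=> x _; exact: (nk _ (E0 n) (x, z)).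
      + exact: (measurableT_comp (mk _ (mE n)) (pair2_measurable z)).
      + apply: measurable_funeM; apply: emeasurable_funD; first exact: m1.
        exact: (measurableT_comp m1 (measurable_shift z)).
      + move=> x _; rewrite -EFinD -EFinM lee_fin.
        have := cutoff_energy_le w s C D w0 wC sD r x z r1.
        move=> /(ler_wpM2r (k0 z)) hh; apply: (le_trans hh); rewrite le_eqVlt; apply/orP; left.
        by apply/eqP; rewrite /h /A C1E; ring.
    have mz : measurable_fun setT (fun x : X => (\1_A (x + z)%R : R)%:E).
      exact: (measurableT_comp m1 (measurable_shift z)).
    have i0' x : setT x -> (0 <= (\1_A x : R)%:E)%E by move=> _; exact: i0.
    have i1' x : setT x -> (0 <= (\1_A (x + z)%R : R)%:E)%E by move=> _; exact: i0.
    have i2' x : setT x -> (0 <= (\1_A x : R)%:E + (\1_A (x + z)%R : R)%:E)%E.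
      by move=> _; apply: adde_ge0; exact: i0.
    have mz2 := emeasurable_funD m1 mz.
    rewrite (ge0_integralZl_EFin mu measurableT i2' mz2 h0).
    rewrite (ge0_integralD mu measurableT i0' m1 i1' mz).
    rewrite muA muA' -EFinD -!EFinM lee_fin /h le_eqVlt; apply/orP; left; apply/eqP; ring.
rewrite ge0_integralZl_EFin.
- by rewrite [leRHS]EFinM; apply: lee_wpmul2l; [rewrite lee_fin mulr_ge0|exact: hC0].
- exact: measurableT.
- by move=> z _; rewrite lee_fin !mulr_ge0 ?near_far_ge0// ltW.
- apply/measurable_EFinP; apply: measurable_funM; first exact: measurable_cst.
  apply: measurable_funM.
    exact: (measurable_borel_lebesgue _ _ _ (measurable_near_far r)).
  exact: measurable_ker0.
- by rewrite mulr_ge0.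
Qed.

Let e01 n x : 0 <= e n x <= 1.
Proof. by rewrite cutoff_ge0 cutoff_le1. Qed.

Let e_out n x : 2 * n.+1%:R < `|x| -> e n x = 0.
Proof. by apply: cutoff_out; rewrite ltr0n. Qed.

Let e_eventually1 x : \forall n \near \oo, e n x = 1.
Proof.
have : \forall n \near \oo, `|x| <= n%:R by exact: nbhs_infty_ger.
apply: filterS => n xn; apply: cutoff_in; first by rewrite ltr0n.
by apply: (le_trans xn); rewrite ler_nat.
Qed.

Let cE n z : continuous (E n ^~ z).
Proof.
have ca f := continuous_translate f z.
move=> x; apply: cvgM; last by apply: cvgM; [exact: cw|exact: ca].
apply: cvgM; apply: cvgM.
- by apply: cvgB; [exact: ce|apply: ca; exact: ce].
- by apply: cvgB; [exact: ce|apply: ca; exact: ce].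
- by apply: cvgD; [exact: cs|exact: ca].
- by apply: cvgD; [exact: cs|exact: ca].
Qed.

Let cW z : continuous (W ^~ z).
Proof.
have ca f := continuous_translate f z.
move=> x; apply: cvgM; last by apply: cvgM; [exact: cw|exact: ca].
by apply: cvgM; apply: cvgB; [exact: cs|exact: ca|exact: cs|exact: ca].
Qed.

Let out2 n x z : 2 * n.+1%:R + `|z| < `|x| -> e n x = 0 /\ e n (x + z) = 0.
Proof.
move=> xM; split; apply: e_out; first by have := normr_ge0 z; move: xM; lra.
by have := ler_normB (x + z) z; rewrite addrK; move: xM; lra.
Qed.

Let IE n z : mu.-integrable setT (fun x => (E n x z)%:E).
Proof.
apply: (integrable_compact_support (E n ^~ z) (E n ^~ z) (2 * n.+1%:R + `|z|)) => //.
  by apply: continuous_measurable_fun; exact: cE.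
move=> x /out2[h1 h2]; rewrite /E /cutoff_energy.
by rewrite -/(e n x) -/(e n (x + z)) h1 h2 subrr expr0n/= !mul0r.
Qed.

Let ITl n z : mu.-integrable setT (fun x => (Tl n x z)%:E).
Proof.
apply: (integrable_compact_support (Tl n ^~ z) (W ^~ z) (2 * n.+1%:R + `|z|)) => //.
- exact: (measurableT_comp (mTl n) (pair2_measurable (z : T))).
- move=> x _; rewrite !ger0_norm ?Tl0 ?W0// /Tl.
  by case: (_ == _) => /=; rewrite ?mul1r// mul0r W0.
- by move=> x /out2[h1 h2]; rewrite /Tl h1 h2 eqxx mul0r.
Qed.

Let IW_le n q r :=
  energy_inequality w s c Cw Cwt Gw Gwt cs w0
    Lw Lwt (e n) (2 * n.+1%:R) (ce n) (e_out n) (mulr_ge0 (ler0n R 2) (ler0n R n.+1)) q r.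

Let tested_formE n x z : tested_form w s (e n) x z =
  ((e n x) ^+ 2 * s x - (e n (x + z)) ^+ 2 * s (x + z)) * (s x - s (x + z)) * (w x * w (x + z)).
Proof. by rewrite /tested_form; ring. Qed.

Let coarse n : (dbl (I n) <= dbl (E n))%E.
Proof.
apply: (IW_le n) => // x z; rewrite tested_formE /I /W /E /cutoff_energy -/(e n x) -/(e n (x + z)).
have := ler_wpM2r (ww0 x z) (energy_coarse (e n x) (e n (x + z)) (s x) (s (x + z))).
have := mulr_ge0 (mulr_ge0 (sqr_ge0 (e n x - e n (x + z))) (sqr_ge0 (s x + s (x + z)))) (ww0 x z).
lra.
Qed.

Let fine_bound n t : 0 < t ->
  (dbl (I n) <= (t / 4)%:E * dbl (E n) + (t^-1)%:E * dbl (Tl n))%E.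
Proof.
move=> t0; have t4 : 0 <= t / 4 by rewrite divr_ge0// ltW.
have ti : 0 <= t^-1 by rewrite invr_ge0 ltW.
pose r x z := t / 4 * E n x z + t^-1 * Tl n x z.
have r0 x z : 0 <= r x z by rewrite addr_ge0// mulr_ge0.
have mr : measurable_fun setT (fun p : X * T => r p.1 p.2).
  apply: measurable_funD; apply: measurable_funM; first exact: measurable_cst.
  - exact: mE.
  - exact: measurable_cst.
  - exact: mTl.
have h : (dbl (I n) <= dbl r)%E.
  apply: (IW_le n) => //.
    move=> x z; rewrite tested_formE /r /I /W /Tl /E /cutoff_energy -/(e n x) -/(e n (x + z)).
    have := ler_wpM2r (ww0 x z)
      (energy_fine (e n x) (e n (x + z)) (s x) (s (x + z)) t t0 (e01 n x) (e01 n (x + z))).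
    have := I0 n x z; rewrite /I /W; lra.
  move=> z; have -> : (fun x => (r x z)%:E) =
      (fun x => (t / 4)%:E * (E n x z)%:E + (t^-1)%:E * (Tl n x z)%:E)%E.
    by apply/funext => x; rewrite -!EFinM -EFinD.
  apply: (integrableD measurableT); apply: (integrableZl measurableT); [exact: IE|exact: ITl].
apply: (le_trans h); rewrite /dbl.
have mEk := mk _ (mE n); have mTk := mk _ (mTl n).
have -> : (\int[mu \x cmu]_p (r p.1 p.2 * k p.2)%:E =
  \int[mu \x cmu]_p ((t / 4)%:E * (E n p.1 p.2 * k p.2)%:E + (t^-1)%:E * (Tl n p.1 p.2 * k p.2)%:E))%E.
  by apply: eq_integral => p _; rewrite -!EFinM -EFinD; congr EFin; rewrite /r; ring.
have a1 (p : X * T) : setT p -> (0 <= (t / 4)%:E * (E n p.1 p.2 * k p.2)%:E)%E.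
  by move=> _; rewrite mule_ge0// (nk _ (E0 n)).
have a2 (p : X * T) : setT p -> (0 <= (t^-1)%:E * (Tl n p.1 p.2 * k p.2)%:E)%E.
  by move=> _; rewrite mule_ge0// (nk _ (Tl0 n)).
have a3 : measurable_fun setT (fun p : X * T => (t / 4)%:E * (E n p.1 p.2 * k p.2)%:E)%E.
  exact: measurable_funeM.
have a4 : measurable_fun setT (fun p : X * T => (t^-1)%:E * (Tl n p.1 p.2 * k p.2)%:E)%E.
  exact: measurable_funeM.
rewrite (ge0_integralD _ measurableT a1 a3 a2 a4).
rewrite (ge0_integralZl_EFin _ measurableT (fun p _ => nk _ (E0 n) p) mEk t4).
by rewrite (ge0_integralZl_EFin _ measurableT (fun p _ => nk _ (Tl0 n) p) mTk ti).
Qed.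

(* the cutoffs increase to 1, and I n increases to W / 2 *)
Let limit_bound (B : \bar R) : (forall n, dbl (I n) <= B)%E ->
  (dbl (fun x z => 2^-1 * W x z)%R <= B)%E.
Proof.
move=> hB.
pose g n (p : X * T) := (I n p.1 p.2 * k p.2)%:E.
have mg n : measurable_fun setT (g n) by exact: mk (mI n).
have g0 n p : setT p -> (0 <= g n p)%E by move=> _; exact: nk (I0 n) p.
have ndg p : setT p -> nondecreasing_seq (g ^~ p).
  move=> _; apply/nondecreasing_seqP => n; rewrite /g lee_fin ler_wpM2r// /I ler_wpM2l//.
  rewrite ler_wpM2r//; apply: lerD; rewrite lerXn2r ?nnegrE ?cutoff_ge0//;
  by apply: cutoff_mono; rewrite ?ltr0n// ler_nat.
have := @cvg_monotone_convergence _ _ _ (mu \x cmu)%E setT measurableT g mg g0 ndg.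
have -> : (\int[mu \x cmu]_p limn (g ^~ p) = dbl (fun x z => 2^-1 * W x z)%R)%E.
  apply: eq_integral => p _; apply/cvg_lim => //; apply: cvg_near_cst.
  have := e_eventually1 p.1; have := e_eventually1 (p.1 + p.2).
  apply: filterS2 => n h1 h2; rewrite /g /I h1 h2 expr1n; congr EFin; by field.
move=> cv; rewrite -(cvg_lim _ cv)//; apply: lime_le; last exact: nearW.
by apply/cvg_ex; eexists; exact: cv.
Qed.

Let oscillation_eq0 : dbl (fun x z => 2^-1 * W x z) = 0%E.
Proof.
have [B B0 hB] := energy_bound.
have m2W : measurable_fun setT (fun p : X * T => 2^-1 * W p.1 p.2).
  by apply: measurable_funM; [exact: measurable_cst|exact: mW].
have W20 x z : 0 <= 2^-1 * W x z by rewrite mulr_ge0.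
have fin : (dbl (fun x z => 2^-1 * W x z)%R <= B%:E)%E.
  by apply: limit_bound => n; apply: (le_trans (coarse n)); exact: hB.
(* dominated convergence for the tails: the two cutoff values eventually agree *)
have tail : (dbl (Tl n) @[n --> \oo] --> 0)%E.
  pose g (p : X * T) := (2%:E * (2^-1 * W p.1 p.2 * k p.2)%:E)%E.
  have Ig : (mu \x cmu)%E.-integrable setT g.
    apply: (integrableZl measurableT); apply/integrableP; split; first exact: (mk (fun x z => 2^-1 * W x z) m2W).
    have -> : (\int[mu \x cmu]_p `|(2^-1 * W p.1 p.2 * k p.2)%:E| =
      dbl (fun x z => 2^-1 * W x z)%R)%E.
      by apply: eq_integral => p _; rewrite gee0_abs//; exact: (nk _ W20).
    by rewrite (le_lt_trans fin)// ltry.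
  have mg n : measurable_fun setT (fun p : X * T => (Tl n p.1 p.2 * k p.2)%:E) by exact: mk (mTl n).
  have cv : {ae (mu \x cmu)%E, forall p, setT p ->
      (fun n => (Tl n p.1 p.2 * k p.2)%:E) @ \oo --> cst 0%E p}.
    apply: aeW => p _; apply: cvg_near_cst.
    have := e_eventually1 p.1; have := e_eventually1 (p.1 + p.2).
    by apply: filterS2 => n h1 h2; rewrite /Tl h1 h2 eqxx !mul0r.
  have dom : {ae (mu \x cmu)%E, forall p n, setT p -> (`|(Tl n p.1 p.2 * k p.2)%:E| <= g p)%E}.
    apply: aeW => p n _; rewrite gee0_abs; last exact: (nk _ (Tl0 n)).
    rewrite /g -EFinM lee_fin -(mulrA 2^-1) mulVKf// ler_wpM2r// /Tl.
    by case: (_ == _) => /=; rewrite ?mul1r// mul0r W0.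
  have [_ _] := dominated_convergence measurableT mg (measurable_cst _) cv Ig dom.
  by rewrite integral0.
apply/eqP; rewrite eq_le; apply/andP; split; last by apply: integral_ge0 => p _; exact: (nk _ W20).
apply/lee_addgt0Pr => d d0; rewrite add0e.
(* t is small enough for the energy of the cutoff, and m large enough, given t, for the tail *)
have [t t0 tB] : exists2 t, 0 < t & t * (B + 1) = d.
  have B1 : 0 < B + 1 by rewrite ltr_wpDl.
  by exists (d / (B + 1)); rewrite ?divr_gt0// divfK// gt_eqF.
have [m _ hm] : \forall m \near \oo, (dbl (Tl m) < (t * (d / 2))%:E)%E.
  have := tail => /fine_cvgP[ffin fcv].
  have h : \forall m \near \oo, (fine (dbl (Tl m)) < t * (d / 2))%R.
    by apply: (cvgr_lt _ fcv); rewrite mulr_gt0// divr_gt0.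
  by move: ffin h; apply: filterS2 => m f1 f2; rewrite -(fineK f1) lte_fin.
have ndI n : (dbl (I n) <= dbl (I (maxn n m)))%E.
  apply: ge0_le_integral.
  - exact: measurableT.
  - by move=> p _; exact: (nk _ (I0 n)).
  - exact: mk (mI n).
  - exact: mk (mI _).
  - move=> p _; rewrite lee_fin ler_wpM2r// /I ler_wpM2l//.
    rewrite ler_wpM2r//; apply: lerD; rewrite lerXn2r ?nnegrE ?cutoff_ge0//;
    by apply: cutoff_mono; rewrite ?ltr0n// ler_nat ltnS leq_maxl.
apply: limit_bound => n; apply: (le_trans (ndI n)); apply: (le_trans (fine_bound _ t t0)).
apply: (@le_trans _ _ (t / 4 * B + t^-1 * (t * (d / 2)))%:E); last first.
  by rewrite lee_fin mulKf ?gt_eqF//; move: tB (mulr_ge0 (ltW t0) B0); lra.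
rewrite EFinD !(EFinM _ B) (EFinM t^-1); apply: leeD; apply: lee_wpmul2l.
- by rewrite lee_fin divr_ge0// ltW.
- exact: hB.
- by rewrite lee_fin invr_ge0 ltW.
- by apply: ltW; apply: hm; exact: leq_maxr.
Qed.

(** If the energy of [s] vanishes then, for almost every [x0], the increments of [s] from [x0]
    vanish for almost every [z]; one such [x0] is enough, by continuity. *)
Lemma ratio_constant_energy : exists q, forall x, s x = q.
Proof.
have m2W : measurable_fun setT (fun p : X * T => 2^-1 * W p.1 p.2).
  by apply: measurable_funM; [exact: measurable_cst|exact: mW].
have W20 x z : 0 <= 2^-1 * W x z by rewrite mulr_ge0.
have := oscillation_eq0; rewrite /dbl (fubini_tonelli1 _ (mk (fun x z => 2^-1 * W x z) m2W) (nk _ W20)) => int0.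
have mF := measurable_fun_fubini_tonelli_F (m2 := cmu) _ (mk (fun x z => 2^-1 * W x z) m2W) (nk _ W20).
have F0 x : (0 <= \int[cmu]_z (2^-1 * W x z * k z)%:E)%E.
  by apply: integral_ge0 => z _; exact: (nk _ W20 (x, z)).
have [x0 hx0] : exists x0 : R, (\int[cmu]_z (2^-1 * W x0 z * k z)%:E = 0)%E.
  have := (@ae_eq_integral_abs _ X R mu setT measurableT _ mF).1.
  have -> : (\int[mu]_x `|fubini_F cmu (fun p : X * T => (2^-1 * W p.1 p.2 * k p.2)%:E) x| = 0)%E.
    by rewrite -[RHS]int0; apply: eq_integral => x _; rewrite gee0_abs//; exact: F0.
  move=> /(_ erefl) [N [mN N0 hN]]; apply: contrapT => /forallNP h.
  have NT : N = setT.
    by apply/seteqP; split => // x _; apply: hN => /= /(_ Logic.I); exact: h.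
  have muT := lebesgue_measure_itv (`]-oo, +oo[ : interval R); rewrite set_itvNyy /= in muT.
  by move: N0; rewrite NT [LHS]muT.
exists (s x0) => x.
have cWx : continuous (fun z => 2^-1 * W x0 z).
  have ca f := continuous_increment f x0.
  move=> z; apply: cvgM; first exact: cvg_cst.
  apply: cvgM; last by apply: cvgM; [exact: cvg_cst|exact: ca].
  by apply: cvgM; apply: cvgB; [exact: cvg_cst|exact: ca|exact: cvg_cst|exact: ca].
have := continuous_ker0_eq0 _ cWx (W20 x0) hx0 (x - x0).
rewrite /W (_ : x0 + (x - x0) = x); last by ring.
move=> /eqP; rewrite mulf_eq0 invr_eq0 pnatr_eq0/= mulf_eq0 sqrf_eq0 mulf_eq0.
by rewrite (gt_eqF (w0 x0)) (gt_eqF (w0 x)) !orbF subr_eq0 => /eqP.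
Qed.

End liouville.

End nonlocal_operator.

(** * The theorem *)

(** For a continuous function an essential bound on an open interval holds everywhere. *)
Lemma Linfty_norm_le (R : realType) (r M : R) (f : R -> R) : continuous f ->
  (Linfty_norm `](- r)%R, r[ f <= M%:E)%E -> forall y, `|y| < r -> `|f y| <= M.
Proof.
move=> cf fM y yr; rewrite leNgt; apply/negP => Mf.
pose g : R -> R := patch (fun=> 0) `](- r), r[%classic f.
have ess : (ess_sup (@completed_lebesgue_measure R) (abse \o (EFin \o g)) <= M%:E)%E.
  move: fM; rewrite /Linfty_norm unlock /Lnorm ifT//.
  have muT := lebesgue_measure_itv (`]-oo, +oo[ : interval R); rewrite set_itvNyy /= in muT.
  by change (0 < @lebesgue_measure R setT)%E; rewrite muT ltry.
have [N [mN N0 hN]] := ess_supP ess.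
have cnf := continuous_normr f cf.
have nearM : \forall z \near y, M < `|f z| by exact: (cvgr_gt _ (cnf y)).
have nearr : \forall z \near y, `|z| < r by exact: (@cvgr_lt _ _ _ _ _ _ (@norm_continuous _ R^o y) _ yr).
have near2 : \forall z \near y, M < `|f z| /\ `|z| < r.
  by apply: filterS2 nearM nearr => z h1 h2; split.
have [z [[fz zr] _ Nz]] := near_not_null _ _ _ mN N0 near2.
apply: Nz; apply: hN; rewrite /= /g patchE mem_set; last by rewrite /= in_itv/= -ltr_norml.
by rewrite lee_fin leNgt fz.
Qed.

Theorem theorem5p2 (R : realType) (s_lo s_hi Lambda1 Lambda2 alpha : R)
    (K c w wt : R -> R)
    (hs_lo : 1 / 2 <= s_lo) (hs : s_lo <= s_hi) (hs_hi : s_hi < 1)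
    (hL1 : 0 <= Lambda1) (hL2 : 0 <= Lambda2)
    (hK : admissible_kernel s_lo s_hi Lambda1 Lambda2 K)
    (halpha : 2 * s_hi - 1 < alpha)
    (hw : C1holder alpha w) (hwt : C1holder alpha wt)
    (hcase :
      [/\ bounded_fun w, bounded_fun wt,
          (holder_seminorm alpha (derive1 w) < +oo)%E /\
          (holder_seminorm alpha (derive1 wt) < +oo)%E,
          forall x, 0 < w x &
          exists c0 R0 : R, [/\ 0 < c0, 0 < R0 &
            forall x, x \notin `[- R0, R0] -> c x <= - c0]]
      \/
      (exists C : R, [/\ 0 < C,
          forall x, C^-1 <= w x <= C &
          forall r : R, 1 < r ->
            (Linfty_norm `](- r)%R, r[ wt <= (C * r `^ (s_lo - 1 / 2))%R%:E)%E]))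
    (hsuper : forall x, 0 <= nonlocal_op K w x - c x * w x)
    (hsol : forall x, nonlocal_op K wt x - c x * wt x = 0) :
  exists k : R, forall x, wt x / w x = k.
Proof.
case: hcase => [[bw bwt [Hw Hwt] w0 [c0 [R0 [c00 R00 hc]]]]|[C [C0 hC hwtC]]].
  exact: (ratio_constant_bounded s_lo s_hi Lambda1 Lambda2 alpha K hs_lo hs hL1 hL2 hK halpha
    w wt c c0 R0).
have w0 x : 0 < w x by have /andP[+ _] := hC x; apply: lt_le_trans; rewrite invr_gt0.
have wC x : w x <= C by case/andP: (hC x).
have cw := C1holder_continuous alpha w hw; have cwt := C1holder_continuous alpha wt hwt.
have gwt y : `|wt y| <= C * (2 + `|y|) `^ (s_lo - 1 / 2).
  apply: (@Linfty_norm_le _ (2 + `|y|)) => //.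
    by apply: hwtC; have := normr_ge0 y; lra.
  by have := normr_ge0 y; lra.
have bw : bounded_fun w.
  exists C; split; first exact: num_real.
  by move=> M CM x _ /=; rewrite ger0_norm ?(ltW (w0 x))// (le_trans (wC x))// ltW.
pose s y := wt y / w y.
have swE : (fun y => s y * w y) = wt.
  by apply/funext => y; rewrite /s divfK// gt_eqF.
have cs : continuous s.
  by move=> x; apply: cvgM; [exact: cwt|apply: cvgV; [rewrite gt_eqF|exact: cw]].
have sD y : `|s y| <= C ^+ 2 * (2 + `|y|) `^ (s_lo - 1 / 2).
  rewrite /s normrM expr2 mulrAC; apply: (ler_pM _ _ (gwt y)) => //.
  rewrite gtr0_norm ?invr_gt0// -[leRHS]invrK lef_pV2 ?posrE ?invr_gt0//.
  by case/andP: (hC y).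
apply: (ratio_constant_energy s_lo s_hi Lambda1 Lambda2 alpha K hs_lo hs hs_hi hL1 hL2 hK halpha
  w s c C (C ^+ 2)) => //.
- by rewrite swE.
- exact: growth_bounded.
- by rewrite swE; exists C.
- by move=> x; rewrite swE -[s x * w x]/((fun y => s y * w y) x) swE.
Qed.
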